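(* Let $\mathbf{Z}$ be the infinite cyclic group and let $T\in\mathbb{Q}[\mathbf{Z}^3\wr\mathbf{Z}]$ be given as $$T:=(s_1+s_1^{-1}+s_2+s_2^{-1}+s_3+s_3^{-1}+7)\,t+t^{-1}(s_1+s_1^{-1}+s_2+s_2^{-1}+s_3+s_3^{-1}+7).$$ Then the spectral measure $\mu_T$ of $T$ has the property that $$\mu_T((0,\varepsilon))\ge\frac{C}{|\log(\varepsilon)|^3}$$ for some $C>0$ and all sufficiently small $\varepsilon>0$.
   Context: The wreath product is $\mathbf{Z}^3\wr\mathbf{Z}=\big(\bigoplus_{\mathbf{Z}}\mathbf{Z}^3\big)\rtimes\mathbf{Z}$, where $\mathbf{Z}$ acts by shifting the coordinates; $t$ is a generator of the acting group $\mathbf{Z}$ and $s_1,s_2,s_3$ are the standard generators of the copy of $\mathbf{Z}^3$ at coordinate $0$. For a discrete group $G$ and a self-adjoint $T\in\mathbb{C}[G]$ (with respect to $(\sum a_g g)^*=\sum\overline{a_g}g^{-1}$), acting by left multiplication on $l^2(G)$ with projection-valued spectral measure $\pi_T$, the spectral measure of $T$ is the measure on $\mathbb{R}$ given by $\mu_T(B)=\langle\pi_T(B)\zeta_e,\zeta_e\rangle$, where $\zeta_e$ is the indicator function of the neutral element of $G$. *)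

(* Defs.v *)
From HB Require Import structures.
From mathcomp Require Import all_boot all_order all_algebra finmap.
From mathcomp Require Import -(notations) monalg.
From mathcomp.real_closed Require Import complex.
From mathcomp Require Import all_classical all_reals all_analysis.
From mathcomp Require Import ring.
From mathcomp.analysis Require showcase.summability.

Set Implicit Arguments.
Unset Strict Implicit.
Unset Printing Implicit Defensive.

Import Order.TTheory GRing.Theory Num.Theory.
Import numFieldNormedType.Exports.
Import Normc.

Local Open Scope classical_set_scope.
Local Open Scope ring_scope.

Section Shift.
Variable A : zmodType.
Implicit Type f : malg int A.

Definition shift (m : int) f : malg int A :=
  \sum_(k <- msupp f) mkmalgU (k + m) (mcoeff k f).

Lemma mcoeff_shift m f k : mcoeff k (shift m f) = mcoeff (k - m) f.
Proof.
rewrite /shift [in RHS](monalgE f) !raddf_sum; apply: eq_bigr => i _ /=.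
by rewrite !mcoeffU -(inj_eq (addIr m) i) subrK.
Qed.

Lemma shift_is_zmod_morphism m : zmod_morphism (shift m).
Proof.
by move=> f g; apply/malgP => k; rewrite mcoeffB !mcoeff_shift mcoeffB.
Qed.

HB.instance Definition _ m :=
  GRing.isZmodMorphism.Build (malg int A) (malg int A) (shift m)
    (shift_is_zmod_morphism m).

Lemma shift0 f : shift 0 f = f.
Proof. by apply/malgP => k; rewrite mcoeff_shift subr0. Qed.

Lemma shift_shift m n f : shift m (shift n f) = shift (m + n) f.
Proof. by apply/malgP => k; rewrite !mcoeff_shift opprD addrA. Qed.
End Shift.

(* A wr Z, for an additively written abelian group A: the lamp configuration is
   an element of the direct sum of copies of A indexed by Z, represented by a
   finitely supported function. *)
Record wreathZ (A : zmodType) : Type :=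
  WreathZ { lamps : malg int A; cursor : int }.

Section WreathZ.
Variable A : zmodType.
Local Notation W := (wreathZ A).

Definition wreathZ_to_pair (x : W) := (lamps x, cursor x).
Definition wreathZ_of_pair (p : malg int A * int) : W := WreathZ p.1 p.2.

Lemma wreathZ_to_pairK : cancel wreathZ_to_pair wreathZ_of_pair.
Proof. by case. Qed.

HB.instance Definition _ := Choice.copy W (can_type wreathZ_to_pairK).

Definition wreathZ_one : W := WreathZ 0 0.
Definition wreathZ_mul (x y : W) : W :=
  WreathZ (lamps x + shift (cursor x) (lamps y)) (cursor x + cursor y).
Definition wreathZ_inv (x : W) : W :=
  WreathZ (shift (- cursor x) (- lamps x)) (- cursor x).

Lemma wreathZ_mulA : associative wreathZ_mul.
Proof.
case=> [f m] [g n] [h p]; rewrite /wreathZ_mul /=.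
by rewrite raddfD /= shift_shift !addrA.
Qed.

Lemma wreathZ_mul1 : left_id wreathZ_one wreathZ_mul.
Proof. by case=> [f m]; rewrite /wreathZ_mul /= shift0 !add0r. Qed.

Lemma wreathZ_mulr1 : right_id wreathZ_one wreathZ_mul.
Proof. by case=> [f m]; rewrite /wreathZ_mul /= raddf0 !addr0. Qed.

Lemma wreathZ_mulV : left_inverse wreathZ_one wreathZ_inv wreathZ_mul.
Proof. by case=> [f m]; rewrite /wreathZ_mul /= -raddfD /= !addNr raddf0. Qed.

Lemma wreathZ_mulrV : right_inverse wreathZ_one wreathZ_inv wreathZ_mul.
Proof.
by case=> [f m]; rewrite /wreathZ_mul /= shift_shift !subrr shift0 subrr.
Qed.

HB.instance Definition _ := isGroup.Build W wreathZ_mulA wreathZ_mul1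
  wreathZ_mulr1 wreathZ_mulV wreathZ_mulrV.

Definition wr_gen : W := WreathZ 0 1.
Definition wr_lamp (a : A) : W := WreathZ (mkmalgU 0 a) 0.
End WreathZ.

(* The multiplication that [monalg] puts on [malg G K] requires a monoid G
   without nontrivial units, hence the separate ring structure. *)
Definition group_algebra (K : nzRingType) (G : groupType) : Type := malg G K.

Section GroupAlgebra.
Variables (K : nzRingType) (G : groupType).
Local Notation KG := (group_algebra K G).
Implicit Types (a b c : KG) (g h : G).

HB.instance Definition _ := GRing.Lmodule.copy KG (malg G K).

Definition galg_of (g : G) : KG := mkmalgU g 1.

Definition galg_mul a b : KG :=
  \sum_(g <- msupp a) \sum_(h <- msupp b)
     mkmalgU (g * h)%g (mcoeff g a * mcoeff h b).

Lemma galg_mulw (d1 d2 : {fset G}) a b :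
  (msupp a `<=` d1)%fset -> (msupp b `<=` d2)%fset ->
  galg_mul a b = \sum_(g <- d1) \sum_(h <- d2)
     mkmalgU (g * h)%g (mcoeff g a * mcoeff h b).
Proof.
move=> le_d1 le_d2; rewrite /galg_mul (big_fset_incl _ le_d1) /=.
  apply/eq_bigr=> k1 _; apply/big_fset_incl => // k _ /mcoeff_outdom ->.
  by rewrite mulr0 monalgU0.
move=> k _ /mcoeff_outdom ak.
by rewrite big1 => // k' _; rewrite ak mul0r monalgU0.
Qed.

Lemma galg_mulDl : left_distributive galg_mul +%R.
Proof.
move=> a b c.
rewrite (@galg_mulw (msupp a `|` msupp b)%fset (msupp c) (a + b)) ?msuppD_le //.
rewrite (@galg_mulw (msupp a `|` msupp b)%fset (msupp c) a) ?fsubsetUl //.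
rewrite (@galg_mulw (msupp a `|` msupp b)%fset (msupp c) b) ?fsubsetUr //.
rewrite -big_split /=; apply/eq_bigr=> k1 _.
rewrite -big_split /=; apply/eq_bigr=> k2 _.
by rewrite mcoeffD mulrDl monalgUD.
Qed.

Lemma galg_mulDr : right_distributive galg_mul +%R.
Proof.
move=> c a b.
rewrite (@galg_mulw (msupp c) (msupp a `|` msupp b)%fset c (a + b)) ?msuppD_le //.
rewrite (@galg_mulw (msupp c) (msupp a `|` msupp b)%fset c a) ?fsubsetUl //.
rewrite (@galg_mulw (msupp c) (msupp a `|` msupp b)%fset c b) ?fsubsetUr //.
rewrite -big_split /=; apply/eq_bigr=> k1 _.
rewrite -big_split /=; apply/eq_bigr=> k2 _.
by rewrite mcoeffD mulrDr monalgUD.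
Qed.

Lemma galg_mul0 : left_zero 0 galg_mul.
Proof. by move=> a; rewrite /galg_mul msupp0 big_seq_fset0. Qed.

Lemma galg_mulr0 : right_zero 0 galg_mul.
Proof.
by move=> a; rewrite /galg_mul big1 // => g _; rewrite msupp0 big_seq_fset0.
Qed.

Lemma galg_mulUU (x y : K) g h :
  galg_mul (mkmalgU g x) (mkmalgU h y) = mkmalgU (g * h)%g (x * y).
Proof. by rewrite (galg_mulw msuppU_le msuppU_le) !big_seq_fset1 !mcoeffUU. Qed.

Lemma galg_mull_sum a b :
  galg_mul a b = \sum_(g <- msupp a) galg_mul (mkmalgU g (mcoeff g a)) b.
Proof.
rewrite {1}[a]monalgE.
exact: (big_morph (galg_mul^~ b) (fun _ _ => galg_mulDl _ _ _) (galg_mul0 _)).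
Qed.

Lemma galg_mulr_sum a b :
  galg_mul a b = \sum_(h <- msupp b) galg_mul a (mkmalgU h (mcoeff h b)).
Proof.
rewrite {1}[b]monalgE.
exact: (big_morph (galg_mul a) (fun _ _ => galg_mulDr _ _ _) (galg_mulr0 _)).
Qed.

Lemma galg_mul1 : left_id (galg_of 1%g) galg_mul.
Proof.
move=> a; rewrite galg_mulr_sum [RHS]monalgE.
by apply/eq_bigr => g _; rewrite galg_mulUU mul1r mul1g.
Qed.

Lemma galg_mulr1 : right_id (galg_of 1%g) galg_mul.
Proof.
move=> a; rewrite galg_mull_sum [RHS]monalgE.
by apply/eq_bigr => g _; rewrite galg_mulUU mulr1 mulg1.
Qed.

Lemma galg_mulA : associative galg_mul.
Proof.
move=> a b c.
rewrite [galg_mul a b]galg_mull_sum.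
rewrite [RHS](big_morph (galg_mul^~ _)
  (fun _ _ => galg_mulDl _ _ _) (galg_mul0 _)).
rewrite galg_mull_sum; apply/eq_bigr => g _.
rewrite [galg_mul b c]galg_mull_sum.
rewrite [LHS](big_morph (galg_mul _)
  (fun _ _ => galg_mulDr _ _ _) (galg_mulr0 _)).
rewrite [galg_mul _ b]galg_mulr_sum.
rewrite [RHS](big_morph (galg_mul^~ _)
  (fun _ _ => galg_mulDl _ _ _) (galg_mul0 _)).
apply/eq_bigr => h _.
rewrite galg_mulUU [galg_mul _ c in LHS]galg_mulr_sum.
rewrite [LHS](big_morph (galg_mul _)
  (fun _ _ => galg_mulDr _ _ _) (galg_mulr0 _)).
rewrite [RHS]galg_mulr_sum; apply/eq_bigr => k _.
by rewrite !galg_mulUU mulrA mulgA.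
Qed.

Lemma galg_one_neq0 : galg_of 1%g != 0.
Proof. by rewrite monalgU_eq0 oner_eq0. Qed.

HB.instance Definition _ := GRing.Zmodule_isNzRing.Build KG
  galg_mulA galg_mul1 galg_mulr1 galg_mulDl galg_mulDr galg_one_neq0.
End GroupAlgebra.

Section L2.
Variables (R : realType) (I : choiceType).
Local Notation C := R[i].

Definition square_summable (xi : I -> C^o) : Prop :=
  (\esum_(i in [set: I]) (normc (xi i) ^+ 2)%:E < +oo)%E.

Definition square_summable_pred : {pred I -> C^o} :=
  fun xi => `[< square_summable xi >].

Lemma normc_ge0 (z : C) : 0 <= normc z.
Proof. by case: z => a b; rewrite sqrtr_ge0. Qed.

Lemma esum_scale_lty (c : R) (f : I -> R) : 0 <= c -> (forall i, 0 <= f i) ->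
  (\esum_(i in [set: I]) (f i)%:E < +oo)%E ->
  (\esum_(i in [set: I]) (c * f i)%:E < +oo)%E.
Proof.
move=> c0 f0 sf.
apply: (@le_lt_trans _ _ (c%:E * \esum_(i in [set: I]) (f i)%:E)%E).
  apply: ge_ereal_sup => _ [X [finX _] <-].
  rewrite (eq_fsbigr (fun i => (c%:E * (f i)%:E)%E)) //.
  rewrite -ge0_mule_fsumr; last by move=> i; rewrite lee_fin.
  by rewrite lee_wpmul2l ?lee_fin //; apply: ereal_sup_ubound; exists X.
by rewrite lte_mul_pinfty ?lee_fin.
Qed.

Lemma square_summable_submod : submod_closed square_summable_pred.
Proof.
split=> [|a xi eta].
  apply/asboolP; rewrite /square_summable esum1 ?ltry// => i _.
  by rewrite normc0 expr0n.
move=> /asboolP sxi /asboolP seta; apply/asboolP.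
apply: (@le_lt_trans _ _ (\esum_(i in [set: I])
  ((2 * normc a ^+ 2 * normc (xi i) ^+ 2)%:E + (2 * normc (eta i) ^+ 2)%:E))%E).
  apply: le_esum => i _; rewrite -EFinD lee_fin.
  apply: (@le_trans _ _ ((normc (a * xi i) + normc (eta i)) ^+ 2)).
    by rewrite lerXn2r ?nnegrE ?addr_ge0 ?normc_ge0 //; exact: le_normcD.
  rewrite normcM -mulrA -exprMn -subr_ge0 [leRHS](_ : _ =
    (normc a * normc (xi i) - normc (eta i)) ^+ 2) ?sqr_ge0 //.
  by ring.
rewrite esumD; last 2 first.
- by move=> i _; rewrite lee_fin !mulr_ge0 ?normc_ge0.
- by move=> i _; rewrite lee_fin !mulr_ge0 ?normc_ge0.
by rewrite lte_add_pinfty // esum_scale_lty // => [|i|i];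
  rewrite ?mulr_ge0 ?normc_ge0 ?sqr_ge0.
Qed.

HB.instance Definition _ :=
  GRing.isSubmodClosed.Build C (I -> C^o) square_summable_pred
    square_summable_submod.

Record l2 : Type := L2 {
  l2_fun :> I -> C^o;
  l2_prop : l2_fun \in square_summable_pred
}.

HB.instance Definition _ := [isSub for l2_fun].
HB.instance Definition _ := [Choice of l2 by <:].
HB.instance Definition _ := [SubChoice_isSubLmodule of l2 by <:].

Definition l2_inner (xi eta : l2) : C :=
  summability.sum (fun i => xi i * ((eta i)^*)%C : C^o).

Lemma l2_delta_subproof (j : I) :
  (fun i => (i == j)%:R : C^o) \in square_summable_pred.
Proof.
apply/asboolP; rewrite /square_summable.
rewrite (esumID [set j]); last by move=> i _; rewrite lee_fin sqr_ge0.
rewrite setTI esum_set1 ?lee_fin ?sqr_ge0 // esum1 ?adde0 ?ltry // => i [_ /eqP].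
by case: eqP => // _; rewrite normc0 expr0n.
Qed.

Definition l2_delta (j : I) : l2 := L2 (l2_delta_subproof j).

Lemma l2_inner_ge0 (xi : l2) : 0 <= complex.Re (l2_inner xi xi).
Proof.
rewrite /l2_inner /summability.sum; set F := (X in lim X).
have [cF|/dvgP->] := pselect (cvg F); last by [].

have pF : ProperFilter F by apply: fmap_proper_filter; exact: summability.totally_filter.
pose S := summability.partial_sum (fun i => xi i * ((xi i)^*)%C : C^o).
have S_ge0 J : 0 <= complex.Re (S J).
  have : 0 <= (S J : C).
    by rewrite /S /summability.partial_sum sumr_ge0 // => i _; exact: mulcJ_ge0.
  by rewrite lecE => /andP[].
rewrite leNgt; apply/negP => ltz.
have e0 : 0 < (- complex.Re (lim F : C))%:C%C by rewrite ltcR oppr_gt0.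
have /cvgr_dist_lt/(_ _ e0) near_F : F --> lim F by exact: cF.
have tf := @summability.totally_filter I.
have [J ltJ] := @filter_ex _ _ tf _ (near_F _).
have := le_lt_trans (normc_ge_Re (lim F - S J : C)) ltJ.
rewrite ltcR raddfB /= ler0_norm; last first.
  by rewrite subr_le0 (le_trans (ltW ltz)) // S_ge0.
by rewrite opprB -subr_lt0 opprK subrK ltNge S_ge0.
Qed.

End L2.

Section LeftRegular.
Variables (R : realType) (G : groupType).
Local Notation l2G := (l2 R G).

Lemma translate_subproof (h : G) (xi : l2G) :
  (fun g => xi (h^-1 * g)%g) \in @square_summable_pred R G.
Proof.
have /asboolP := l2_prop xi; rewrite /square_summable.
rewrite (reindex_esum [set: G] [set: G] (fun g => h^-1 * g)%g) => [sxi|].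
  by apply/asboolP.
split=> // [g1 g2 _ _ /mulgI//|g _].
by exists (h * g)%g => //; rewrite mulKg.
Qed.

Definition translate (h : G) (xi : l2G) : l2G := L2 (translate_subproof h xi).

Definition left_mul (a : group_algebra R[i] G) (xi : l2G) : l2G :=
  \sum_(h <- msupp a) mcoeff h a *: translate h xi.
End LeftRegular.

Section ProjectionValuedMeasure.
Variables (R : realType) (I : choiceType).
Local Notation H := (l2 R I).

(* Boundedness is automatic: an everywhere defined symmetric operator on a
   Hilbert space is bounded. *)
Definition orthogonal_projection (P : H -> H) : Prop :=
  (forall xi, P (P xi) = P xi) /\
  (forall xi eta, l2_inner (P xi) eta = l2_inner xi (P eta)).

Variables (d : measure_display) (T : measurableType d).

(* As for the measures of the library, a projection-valued measure is a total
   function on sets: on non-measurable sets its values are arbitrary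
   projections.  Countable additivity is required in the weak sense, i.e., all
   the set functions A |-> <E A xi, eta> are complex measures. *)
Record projection_valued_measure := ProjectionValuedMeasure {
  pvm_fun :> set T -> {linear H -> H};
  pvm_projection : forall A, orthogonal_projection (pvm_fun A);
  pvm_set0 : forall xi, pvm_fun set0 xi = 0;
  pvm_setT : forall xi, pvm_fun setT xi = xi;
  pvm_setI : forall A B, measurable A -> measurable B ->
    forall xi, pvm_fun (A `&` B) xi = pvm_fun A (pvm_fun B xi);
  pvm_sigma_additive : forall F : (set T)^nat,
    (forall n, measurable (F n)) -> trivIset setT F ->
    forall xi eta,
      (\sum_(0 <= k < n) l2_inner (pvm_fun (F k) xi) eta : R[i]^o) @[n --> \oo]
      --> (l2_inner (pvm_fun (\bigcup_n F n) xi) eta : R[i]^o)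
}.

(* The scalar measure A |-> <E A xi, xi>; the inner product is a nonnegative
   real number by [l2_inner_pvmE]. *)
Definition pvm_measure (E : projection_valued_measure) (xi : H) (A : set T) :
  \bar R := (complex.Re (l2_inner (E A xi) xi))%:E.

Variables (E : projection_valued_measure) (xi : H).

Lemma l2_inner_pvmE A : l2_inner (E A xi) xi = l2_inner (E A xi) (E A xi).
Proof. by have [PP Psym] := pvm_projection E A; rewrite -Psym PP. Qed.

Lemma pvm_measure0 : pvm_measure E xi set0 = 0%E.
Proof.
rewrite /pvm_measure l2_inner_pvmE pvm_set0 /l2_inner /summability.sum.
rewrite (_ : summability.partial_sum _ = cst 0); last first.
  apply/funext => J; rewrite /summability.partial_sum big1 // => i _.
  by rewrite mul0r.
by rewrite (@lim_cst _ (@norm_hausdorff _ R[i]^o) _ _ (@summability.totally_filter I)).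
Qed.

Lemma pvm_measure_ge0 A : (0 <= pvm_measure E xi A)%E.
Proof. by rewrite lee_fin l2_inner_pvmE l2_inner_ge0. Qed.

Lemma pvm_measure_sigma_additive : semi_sigma_additive (pvm_measure E xi).
Proof.
move=> F mF tF mUF.
have := @pvm_sigma_additive E F mF tF xi xi.
set u := (fun n => _); set l := l2_inner _ _ => ul.
rewrite (_ : (fun n => _) = (fun n => (complex.Re (u n : R[i]))%:E)); last first.
  by apply/funext => n; rewrite /u raddf_sum sumEFin.
apply: cvg_EFin; first by near=> n.
apply/cvgrPdist_lt => e e0.
have e0' : 0 < e%:C%C by rewrite ltcR.
move/cvgr_dist_lt : ul => /(_ _ e0'); apply: filterS => n /= h.
rewrite -ltcR -raddfB; apply: le_lt_trans h; exact: normc_ge_Re.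
Unshelve. all: by end_near. Qed.

HB.instance Definition _ := isMeasure.Build d T R (pvm_measure E xi)
  pvm_measure0 pvm_measure_ge0 pvm_measure_sigma_additive.
End ProjectionValuedMeasure.

Section SpectralMeasure.
Variables (R : realType) (I : choiceType).
Local Notation H := (l2 R I).
Local Notation pvmR := (projection_valued_measure R I (measurableTypeR R)).

(* A is the integral of x against E, in the usual weak sense
   <A xi, xi> = \int x d<E x xi, xi>, which determines A by polarization.
   Integrability for all vectors xi amounts to boundedness of the integral. *)
Definition spectral_resolution (A : H -> H) (E : pvmR) : Prop :=
  forall xi : H,
    (pvm_measure E xi).-integrable setT (fun x : measurableTypeR R => x%:E) /\
    l2_inner (A xi) xi =
      (\int[pvm_measure E xi]_x (x : measurableTypeR R))%:C%C.
End SpectralMeasure.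

Definition spectral_measure (R : realType) (G : groupType)
    (E : projection_valued_measure R G (measurableTypeR R)) :=
  pvm_measure E (l2_delta R (1%g : G)).

Definition Z3wrZ : groupType := wreathZ 'rV[int]_3.

Definition Z3wrZ_t : Z3wrZ := wr_gen _.
Definition Z3wrZ_s (i : 'I_3) : Z3wrZ := wr_lamp (delta_mx 0 i).

Definition Z3wrZ_T (K : nzRingType) : group_algebra K Z3wrZ :=
  let t := Z3wrZ_t in
  let s := Z3wrZ_s in
  let u : Z3wrZ -> group_algebra K Z3wrZ := @galg_of K Z3wrZ in
  let p := \sum_(i < 3) (u (s i) + u ((s i)^-1)%g) + 7%:R in
  p * u t + u (t^-1)%g * p.

(* Main.v *)
Require Import Defs.
From HB Require Import structures.
From mathcomp Require Import all_boot all_order all_algebra finmap.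
From mathcomp Require Import -(notations) monalg.
From mathcomp.real_closed Require Import complex.
From mathcomp Require Import all_classical all_reals all_analysis.
From mathcomp Require Import ring lra zify.
From mathcomp Require Import cyclic separable cyclotomic.
From mathcomp.analysis Require showcase.summability.
Import Order.TTheory GRing.Theory Num.Theory.
Import numFieldNormedType.Exports.
Import Normc.
(** Fourier transform in the lamp group turns [T] into a random operator.  A
    character of the lamp group assigns an independent random weight
    [w_n = 7 + 2 (cos + cos + cos)], between [1] and [13], to each edge of the line,
    and [T] becomes the Jacobi matrix with these weights off the diagonal and zero
    diagonal.  Such a matrix has many small eigenvalues: the solution of
    [w_(2k+1) f(2k+1) + w_(2k+2) f(2k+3) = 0] is, up to signs, the exponential of a
    random walk with steps [ln w_(2k+1) - ln w_(2k+2)], which over [L] steps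
    fluctuates by [sqrt L].  With a probability bounded below, a segment of length
    of order [|ln e| ^ 2] carries such a solution that is smaller by a factor [e] at
    the ends than in the middle, and cutting it off at the ends gives an approximate
    zero mode.  Hence a proportion of at least [c / |ln e| ^ 2] of the spectrum lies in
    [(-e, e)], which is more than the theorem asks.

    Two refinements are needed.  First, the interval of the theorem excludes [0].  The
    walk is therefore required to go up, down, up and down, and the two resulting
    bumps are combined so as to be orthogonal to the exact solution
    ([bump_height]).  The combination is then in the range of the Jacobi matrix
    ([jacobi_premode]), so the corresponding vector is almost orthogonal to the
    kernel of [T] ([sqn_shell_ge]).  Second, only the positive half [(0, e)] counts;
    conjugating by the parity of the cursor changes the sign of [T], so both halves
    have the same mass ([sqn_shell_delta]).

    The passage between [l2] and Jacobi matrices uses no integration over the dual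
    group.  In the lamp group one takes a large finite cube of side [N], and the
    characters of [Z/N] truncated to it ([wave]).  The operator [T] acts on them as the
    Jacobi matrix up to boundary errors of size [N ^ (-1/2)] ([left_mul_T_wave]), and
    they form an orthogonal basis of the functions on the cube, so that their total
    spectral mass is that of the delta functions of the cube ([sum_sqn_wave]).  All
    delta functions have the same spectral mass, by right translation; this yields
    the comparison [near_zero_mode_count].  The probability estimate concerns finitely
    many independent uniform variables ([card_two_bumps]) and rests on the second and
    fourth moments of the walk ([walk_tail]).

    About the spectral resolution itself, everything is drawn from the quadratic
    form of [T]: its projections commute with [T] ([spectral_comm]), and operators that
    intertwine [T] with [T] or [- T] respect spectral subspaces, by comparing growth
    rates of iterates ([intertwiner_vanish]). *)

Set Implicit Arguments.
Unset Strict Implicit.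
Unset Printing Implicit Defensive.
Local Open Scope classical_set_scope.
Local Open Scope ring_scope.

(** * The inner product of l2 *)

Section Inner.
Variables (R : realType) (I : choiceType).
Local Notation C := R[i].
Local Notation H := (l2 R I).
Local Notation psum := (@summability.partial_sum I C).
Local Notation tot := (@summability.totally I).

Lemma psumE (x : I -> C) (J : {fset I}) : psum x J = \sum_(i <- J) x i.
Proof. by rewrite /summability.partial_sum big_seq_fsetE. Qed.

Lemma cvg_real_complex (u : {fset I} -> R) (l : R) :
  u J @[J --> tot] --> l ->
  (((u J)%:C)%C : C^o) @[J --> tot] --> ((l%:C)%C : C^o).
Proof.
move=> ul; have tf := @summability.totally_filter I.
apply/cvgrPdist_lt => e e0.
have e0' : 0 < complex.Re e by move: e0; rewrite ltcE => /andP[].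
have eE : e = ((complex.Re e)%:C)%C.
  by move: e0; case: (e) => a b; rewrite ltcE /= => /andP[/eqP -> _].
move/cvgrPdist_lt : ul => /(_ _ e0'); apply: filterS => J.
by rewrite -raddfB /= normc_def /= expr0n addr0 sqrtr_sqr eE ltcR.
Qed.

(** Partial sums increase along inclusion of finite sets and come within any [e]
    of their supremum, so they converge along the filter of growing finite sets
    that defines the inner product. *)
Lemma nonneg_psum_cvg (f : I -> R) : (forall i, 0 <= f i) ->
  (\esum_(i in [set: I]) (f i)%:E < +oo)%E ->
  (\sum_(i <- J) f i) @[J --> tot] --> fine (\esum_(i in [set: I]) (f i)%:E)%E.
Proof.
move=> f0 sf; set s := (\esum_(i in _) _)%E in sf *.
have s0 : (0 <= s)%E by apply: esum_ge0 => i _; rewrite lee_fin.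
have sfin : s \is a fin_num by rewrite ge0_fin_numE.
have tf := @summability.totally_filter I.
have up (J : {fset I}) : \sum_(i <- J) f i <= fine s.
  rewrite -lee_fin fineK // -sumEFin fsbig_seq ?fset_uniq //.
  by apply: ereal_sup_ubound; exists [set` J].
apply/cvgrPdist_le => e e0.
have : (s - e%:E < s)%E by rewrite lteBlDr // -{1}[s]adde0 lteD2lE // lte_fin.
rewrite {2}/s => /ereal_sup_gt [_ [X [finX _] <-]] /=.
rewrite fsbig_finite // => ltX.
exists (fset_set X) => // J /= XJ.
rewrite ger0_norm ?subr_ge0 // lerBlDr -lerBlDl.
apply: (@le_trans _ _ (\sum_(i <- fset_set X) f i)).
  by rewrite -lee_fin EFinB fineK // -sumEFin ltW.
rewrite [leRHS](big_fsetID _ (mem (fset_set X))) /=.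
rewrite (_ : [fset x in J | x \in fset_set X]%fset = fset_set X).
  by rewrite lerDl sumr_ge0.
apply/fsetP => i; rewrite !inE andbC; case: (boolP (i \in fset_set X)) => //= iX.
exact: (fsubsetP XJ).
Qed.

Lemma l2Z a (xi : H) i : (a *: xi) i = a * xi i. Proof. by []. Qed.
Lemma l20 i : (0 : H) i = 0. Proof. by []. Qed.
Lemma l2P (xi eta : H) : (forall i, xi i = eta i) -> xi = eta.
Proof. by move=> h; apply: val_inj; apply/funext. Qed.

Lemma cvg_sum_sq (xi : H) :
  ((\sum_(i <- J) (normc (xi i) ^+ 2)%:C%C) : C^o) @[J --> tot] -->
  (((fine (\esum_(i in [set: I]) (normc (xi i) ^+ 2)%:E)%E)%:C)%C : C^o).
Proof.
have /asboolP := l2_prop xi.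
move=> /(nonneg_psum_cvg (fun i => sqr_ge0 (normc (xi i)))) ul.
have := cvg_real_complex ul.
by under eq_fun do rewrite (raddf_sum (real_complex R)).
Qed.

(** Used to deduce the convergence of inner products from that of the
    nonnegative series of square norms. *)
Lemma polarization (a b : C) : a * (b^*)%C = 4^-1 *
   ((normc (a + b) ^+ 2)%:C%C - (normc (a - b) ^+ 2)%:C%C
    + 'i%C * (normc (a + 'i%C * b) ^+ 2)%:C%C
    - 'i%C * (normc (a - 'i%C * b) ^+ 2)%:C%C).
Proof.
have nE (z : C) : (normc z ^+ 2)%:C%C = z * (z^*)%C.
  rewrite -sqr_normc /Num.norm /= rmorphXn //.
rewrite !nE.
apply: (mulfI (_ : 4 != 0 :> C)); first by rewrite pnatr_eq0.
rewrite [RHS]mulrA divff ?mul1r ?pnatr_eq0 //.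
have : ('i^*)%C = - 'i%C :> C by apply/eqP; rewrite eq_complex /= oppr0 !eqxx.
have : 'i%C * 'i%C = -1 :> C by rewrite -expr2 sqr_i.
move: 'i%C => i ii ic.
rewrite !rmorphD !rmorphN !rmorphM /= ic.
rewrite [RHS](_ : _ = (2 - 2 * (i * i)) * a * (b^*)%C
  + (2 + 2 * (i * i)) * (a^*)%C * b); last by ring.
by rewrite ii; ring.
Qed.

(** A relational form of the inner product: stating the limit as a parameter lets
    algebraic identities be read off from limits of finite sums. *)
Definition has_inner (xi eta : H) : C -> Prop := fun l =>
 ((\sum_(i <- J) xi i * ((eta i)^*)%C) : C^o) @[J --> tot] --> (l : C^o).

Lemma has_inner_ex (xi eta : H) : exists l, has_inner xi eta l.
Proof.
have tf := @summability.totally_filter I.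
move: (@cvg_sum_sq (xi + eta)) (@cvg_sum_sq (xi - eta)).
move: (@cvg_sum_sq (xi + 'i%C *: eta)) (@cvg_sum_sq (xi - 'i%C *: eta)).
set l3 := real_complex _ _ => h3; set l4 := real_complex _ _ => h4.
set l1 := real_complex _ _ => h1; set l2 := real_complex _ _ => h2.
exists (4^-1 * (l1 - l2 + 'i%C * l3 - 'i%C * l4)); rewrite /has_inner.
under eq_fun do under eq_bigr do rewrite polarization.
under eq_fun do rewrite -mulr_sumr !big_split /= !sumrN -!mulr_sumr.
have h3' := @cvgMl_tmp C _ _ tf _ 'i%C _ h3.
have h4' := @cvgMl_tmp C _ _ tf _ 'i%C _ h4.
have h := @cvgB C C^o _ _ tf _ _ _ _ h1 h2.
have h' := @cvgD C C^o _ _ tf _ _ _ _ h h3'.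
have h'' := @cvgB C C^o _ _ tf _ _ _ _ h' h4'.
exact: (@cvgMl_tmp C _ _ tf _ 4^-1 _ h'').
Qed.

Lemma has_inner_eq (xi eta : H) (l : C) : has_inner xi eta l -> l2_inner xi eta = l.
Proof.
have tf := @summability.totally_filter I.
move=> h; rewrite /l2_inner /summability.sum.
apply: (@cvg_lim C^o) => //.
rewrite /has_inner in h.
have -> // : psum (fun i => xi i * ((eta i)^*)%C) =
  (fun J : {fset I} => \sum_(i <- J) xi i * ((eta i)^*)%C).
by apply/funext => J; exact: psumE.
Qed.

Lemma has_innerP (xi eta : H) : has_inner xi eta (l2_inner xi eta).
Proof. by have [l h] := has_inner_ex xi eta; rewrite (has_inner_eq h). Qed.

Lemma ipDl (x y z : H) : l2_inner (x + y) z = l2_inner x z + l2_inner y z.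
Proof.
have tf := @summability.totally_filter I.
apply: has_inner_eq; have h := @cvgD C C^o _ _ tf _ _ _ _ (@has_innerP x z) (@has_innerP y z).
rewrite /has_inner; apply: (cvg_trans _ h).
apply: (@near_eq_cvg _ _ tot); apply: nearW => J /=.
by under [RHS]eq_bigr do rewrite mulrDl; rewrite big_split.
Qed.

Lemma ipZl a (x z : H) : l2_inner (a *: x) z = a * l2_inner x z.
Proof.
have tf := @summability.totally_filter I.
apply: has_inner_eq; have h := @cvgMl_tmp C _ _ tf _ a _ (@has_innerP x z).
rewrite /has_inner; apply: (cvg_trans _ h).
apply: (@near_eq_cvg _ _ tot); apply: nearW => J /=.
by under [RHS]eq_bigr do rewrite -mulrA; rewrite -mulr_sumr.
Qed.

Lemma ipC (x y : H) : l2_inner y x = ((l2_inner x y)^*)%C.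
Proof.
have tf := @summability.totally_filter I.
apply: has_inner_eq; have h := @has_innerP x y; rewrite /has_inner in h *.
apply/cvgrPdist_lt => e e0; move/cvgrPdist_lt : h => /(_ _ e0).
apply: filterS => J; rewrite -[X in X < _]normcJ rmorphB rmorph_sum /=.
congr (`|_ - _| < _).
by apply: eq_bigr => i _; rewrite rmorphM /= conjcK mulrC.
Qed.

Lemma ip_delta (x : H) j : l2_inner x (l2_delta R j) = x j.
Proof.
have tf := @summability.totally_filter I.
apply: has_inner_eq; rewrite /has_inner.
apply: (@cvg_trans _ ((fun=> x j) @ tot)); last exact: cvg_cst.
apply: (@near_eq_cvg _ _ tot).
exists [fset j]%fset => // J /fsubsetP sJ.
have jJ : j \in J by apply: sJ; rewrite inE.
rewrite (big_fsetD1 j) //= eqxx conjc1 mulr1 big1_seq ?addr0 // => i.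
by rewrite /= in_fsetD1 => /andP[/negbTE -> _]; rewrite conjc0 mulr0.
Qed.

Lemma ip_diag (x : H) :
  l2_inner x x = ((fine (\esum_(i in [set: I]) (normc (x i) ^+ 2)%:E)%E)%:C)%C.
Proof.
have tf := @summability.totally_filter I.
apply: has_inner_eq; rewrite /has_inner; apply: (cvg_trans _ (@cvg_sum_sq x)).
apply: (@near_eq_cvg _ _ tot); apply: nearW => J /=.
by apply: eq_bigr => i _; rewrite -sqr_normc rmorphXn.
Qed.

End Inner.

(** * Norms in l2 *)

Lemma nonneg_quadratic (R : realFieldType) (a b c : R) : 0 <= a -> 0 <= c ->
  (forall t, 0 <= a * t ^+ 2 + 2 * b * t + c) -> b ^+ 2 <= a * c.
Proof.
move=> a0 c0 h; have [a00|a1] := eqVneq a 0.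
  rewrite a00 mul0r; have [->|b0] := eqVneq b 0; first by rewrite expr0n.
  have := h (- (c + 1) / (2 * b)).
  rewrite a00 mul0r add0r mulrCA divff ?mulr1; last by rewrite mulf_neq0 ?pnatr_eq0.
  by lra.
have ap : 0 < a by rewrite lt_neqAle eq_sym a1.
have := h (- b / a); rewrite -(pmulr_rge0 _ ap).
rewrite (_ : a * (_ + _) = a * c - b ^+ 2) ?subr_ge0 //.
by field.
Qed.

Section Norm.
Variables (R : realType) (I : choiceType).
Local Notation C := R[i].
Local Notation H := (l2 R I).
Implicit Types (x y z : H) (a b : C).

Lemma ipDr x y z : l2_inner x (y + z) = l2_inner x y + l2_inner x z.
Proof. by rewrite ipC ipDl rmorphD /= -!ipC. Qed.

Lemma ipZr a x y : l2_inner x (a *: y) = (a^*)%C * l2_inner x y.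
Proof. by rewrite ipC ipZl rmorphM /= -ipC. Qed.

Lemma ip0l y : l2_inner 0 y = 0.
Proof. by rewrite -(scale0r 0) ipZl mul0r. Qed.

Lemma ip0r y : l2_inner y 0 = 0.
Proof. by rewrite ipC ip0l conjc0. Qed.

Lemma ip_suml (T : Type) (s : seq T) (P : pred T) (F : T -> H) y :
  l2_inner (\sum_(t <- s | P t) F t) y = \sum_(t <- s | P t) l2_inner (F t) y.
Proof. exact: (big_morph (fun x => l2_inner x y) (fun _ _ => ipDl _ _ _) (ip0l y)). Qed.

Lemma ip_sumr (T : Type) (s : seq T) (P : pred T) (F : T -> H) y :
  l2_inner y (\sum_(t <- s | P t) F t) = \sum_(t <- s | P t) l2_inner y (F t).
Proof. exact: (big_morph (l2_inner y) (fun _ _ => ipDr _ _ _) (ip0r y)). Qed.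

(** The real part of the inner product makes [l2] a real inner product space.
    Complex scalars are needed only for characters and to see that an operator
    with real quadratic form is symmetric; everything else uses [rdot]. *)
Definition rdot x y : R := complex.Re (l2_inner x y).
Definition sqn x : R := rdot x x.
Definition l2norm x : R := Num.sqrt (sqn x).

Lemma rdotC x y : rdot x y = rdot y x.
Proof. by rewrite /rdot ipC; case: (l2_inner y x). Qed.

Lemma rdotDl x y z : rdot (x + y) z = rdot x z + rdot y z.
Proof. by rewrite /rdot ipDl raddfD. Qed.

Lemma rdotDr x y z : rdot x (y + z) = rdot x y + rdot x z.
Proof. by rewrite rdotC rdotDl !(rdotC _ x). Qed.

Lemma rdotZl (c : R) x y : rdot (c%:C%C *: x) y = c * rdot x y.
Proof. by rewrite /rdot ipZl; case: (l2_inner x y) => u v /=; rewrite mul0r subr0. Qed.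

Lemma rdotZr (c : R) x y : rdot x (c%:C%C *: y) = c * rdot x y.
Proof. by rewrite rdotC rdotZl rdotC. Qed.

Lemma rdotNl x y : rdot (- x) y = - rdot x y.
Proof. by rewrite -scaleN1r -[X in X *: x](rmorphN1 (real_complex R)) rdotZl mulN1r. Qed.

Lemma rdotNr x y : rdot x (- y) = - rdot x y.
Proof. by rewrite rdotC rdotNl rdotC. Qed.

Lemma rdot0l x : rdot 0 x = 0. Proof. by rewrite /rdot ip0l. Qed.
Lemma rdot0r x : rdot x 0 = 0. Proof. by rewrite rdotC rdot0l. Qed.

Lemma sqn_ge0 x : 0 <= sqn x. Proof. exact: l2_inner_ge0. Qed.
Lemma sqn0 : sqn 0 = 0. Proof. exact: rdot0l. Qed.

Lemma ip_sqn x : l2_inner x x = ((sqn x)%:C)%C.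
Proof.
apply/eqP; rewrite eq_complex /= /sqn /rdot eqxx /=.
have := congr1 (@complex.Im R) (ipC x x).
case: (l2_inner x x) => u v /= /eqP; rewrite -subr_eq0 opprK -mulr2n mulrn_eq0 /=.
by move=> /eqP ->.
Qed.

Lemma sqnD x y : sqn (x + y) = sqn x + 2 * rdot x y + sqn y.
Proof. by rewrite /sqn rdotDl !rdotDr (rdotC y x); ring. Qed.

Lemma sqnB x y : sqn (x - y) = sqn x - 2 * rdot x y + sqn y.
Proof. by rewrite sqnD {2}/sqn rdotNr rdotNl rdotNr /sqn; ring. Qed.

Lemma sqnZ a x : sqn (a *: x) = normc a ^+ 2 * sqn x.
Proof.
rewrite /sqn {1}/rdot ipZl ipZr mulrA -sqr_normc ip_sqn.
rewrite (_ : _ * _ = ((normc a ^+ 2 * sqn x)%:C)%C) //.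
by rewrite rmorphM rmorphXn.
Qed.

Lemma sqnN x : sqn (- x) = sqn x.
Proof. by rewrite /sqn rdotNl rdotNr opprK. Qed.

Lemma cauchy_schwarz_sq x y : rdot x y ^+ 2 <= sqn x * sqn y.
Proof.
apply: nonneg_quadratic => [||t]; [exact: sqn_ge0|exact: sqn_ge0|].
rewrite (_ : _ + _ = sqn (t%:C%C *: x + y)) ?sqn_ge0 //.
by rewrite sqnD rdotZl {3}/sqn rdotZl rdotZr /sqn; ring.
Qed.

Lemma sqn_eq0 x : sqn x = 0 -> x = 0.
Proof.
move=> x0; have r0 y : rdot x y = 0.
  by apply/eqP; rewrite -sqrf_eq0 eq_le sqr_ge0 andbT (le_trans (cauchy_schwarz_sq _ _)) // x0 mul0r.
apply: l2P => i; rewrite l20 -(ip_delta x i).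
have := r0 (l2_delta R i); have := r0 ('i%C *: l2_delta R i).
rewrite /rdot ipZr; case: (l2_inner _ _) => u v /=.
by rewrite mul0r sub0r mulN1r opprK => -> ->.
Qed.

Lemma l2norm_ge0 x : 0 <= l2norm x. Proof. exact: sqrtr_ge0. Qed.
Lemma l2norm_sq x : l2norm x ^+ 2 = sqn x.
Proof. by rewrite sqr_sqrtr // sqn_ge0. Qed.

Lemma cauchy_schwarz x y : `|rdot x y| <= l2norm x * l2norm y.
Proof.
rewrite -(@ler_pXn2r _ 2) // ?nnegrE ?mulr_ge0 ?l2norm_ge0 //.
by rewrite real_normK ?num_real // exprMn !l2norm_sq cauchy_schwarz_sq.
Qed.

Lemma l2normD x y : l2norm (x + y) <= l2norm x + l2norm y.
Proof.
rewrite -(@ler_pXn2r _ 2) // ?nnegrE ?addr_ge0 ?l2norm_ge0 //.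
rewrite l2norm_sq sqnD sqrrD !l2norm_sq.
have := le_trans (ler_norm _) (cauchy_schwarz x y); lra.
Qed.

Lemma l2normZ a x : l2norm (a *: x) = normc a * l2norm x.
Proof. by rewrite /l2norm sqnZ sqrtrM ?sqr_ge0 // sqrtr_sqr ger0_norm // normc_ge0. Qed.

Lemma l2normN x : l2norm (- x) = l2norm x. Proof. by rewrite /l2norm sqnN. Qed.
Lemma l2norm0 : l2norm 0 = 0. Proof. by rewrite /l2norm sqn0 sqrtr0. Qed.

Lemma l2norm_sum (T : Type) (s : seq T) (P : pred T) (F : T -> H) :
  l2norm (\sum_(t <- s | P t) F t) <= \sum_(t <- s | P t) l2norm (F t).
Proof.
elim/big_rec2 : _ => [|t u v _ h]; first by rewrite l2norm0.
exact: le_trans (l2normD _ _) (lerD _ h).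
Qed.

Lemma l2norm_le x (c : R) : 0 <= c -> (l2norm x <= c) = (sqn x <= c ^+ 2).
Proof. by move=> c0; rewrite -l2norm_sq ler_pXn2r // nnegrE ?l2norm_ge0. Qed.

End Norm.

(** * Projection-valued measures and spectral resolutions *)

Section Projections.
Variables (R : realType) (I : choiceType).
Variables (d : measure_display) (T : measurableType d).
Local Notation H := (l2 R I).
Variable E : projection_valued_measure R I T.
Implicit Types (x y : H) (A B : set T).

Lemma pvm_idem A x : E A (E A x) = E A x.
Proof. by have [h _] := pvm_projection E A. Qed.

Lemma pvm_sym A x y : rdot (E A x) y = rdot x (E A y).
Proof. by rewrite /rdot; have [_ ->] := pvm_projection E A. Qed.

Lemma pvm_sqn A x : sqn (E A x) = rdot (E A x) x.
Proof. by rewrite /sqn -pvm_sym pvm_idem. Qed.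

Lemma pvm_measureE x A : pvm_measure E x A = (sqn (E A x))%:E.
Proof. by rewrite pvm_sqn. Qed.

Lemma pvm_measure_fin x : fin_num_fun (pvm_measure E x).
Proof. by []. Qed.

HB.instance Definition _ x :=
  Measure_isFinite.Build d T R (pvm_measure E x) (pvm_measure_fin x).

(** [sqn (E A x)] is the mass that the scalar measure of [x] gives to [A], so it is
    additive on disjoint sets. *)
Lemma sqn_setU A B x : measurable A -> measurable B -> A `&` B = set0 ->
  sqn (E (A `|` B) x) = sqn (E A x) + sqn (E B x).
Proof.
move=> mA mB AB; apply/EFin_inj.
rewrite EFinD -!pvm_measureE.
by rewrite (measureU (pvm_measure E x)) //.
Qed.

Lemma pvm_disjoint A B x : measurable A -> measurable B -> A `&` B = set0 ->
  E A (E B x) = 0.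
Proof. by move=> mA mB AB; rewrite -pvm_setI // AB pvm_set0. Qed.

Lemma pvm_restrict A B x : measurable A -> measurable B -> A `<=` B ->
  E A (E B x) = E A x.
Proof. by move=> mA mB AB; rewrite -pvm_setI // setIidl. Qed.

Lemma sqn_pvm_le A x : sqn (E A x) <= sqn x.
Proof.
have := sqn_ge0 (x - E A x); rewrite sqnB rdotC -pvm_sqn; lra.
Qed.

Lemma sqn_pvm_mono A B x : measurable A -> measurable B -> A `<=` B ->
  sqn (E A x) <= sqn (E B x).
Proof. by move=> mA mB AB; rewrite -(pvm_restrict x mA mB AB) sqn_pvm_le. Qed.

Lemma sqn_setC A x : measurable A -> sqn x = sqn (E A x) + sqn (E (~` A) x).
Proof.
move=> mA; rewrite -{1}(pvm_setT E x) -(setUv A) sqn_setU //.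
  exact: measurableC.
by rewrite setICr.
Qed.

(** Expand the square norm of [x - E A x - E (~` A) x]: the two projections are
    orthogonal and the masses of [A] and its complement add up to [sqn x]. *)
Lemma pvm_setC A x : measurable A -> x = E A x + E (~` A) x.
Proof.
move=> mA; apply/eqP; rewrite -subr_eq0; apply/eqP/sqn_eq0.
have mA' := measurableC mA.
rewrite opprD addrA sqnB sqnB rdotDl rdotNl.
rewrite -(pvm_sym A) (pvm_sym A x (E _ x)) pvm_disjoint ?setICr // rdot0r.
rewrite !(rdotC x) -!pvm_sqn.
by have := sqn_setC x mA; lra.
Qed.

Lemma sqn_bigcup_eq0 (F : (set T)^nat) x :
  (forall n, measurable (F n)) -> (forall n, E (F n) x = 0) ->
  E (\bigcup_n F n) x = 0.
Proof.
move=> mF F0; apply: sqn_eq0; apply: EFin_inj; rewrite -pvm_measureE.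
have mU : measurable (\bigcup_n F n) by exact: bigcup_measurable.
apply/(negligibleP (pvm_measure E x) mU).
apply: negligible_bigcup => k; apply/(negligibleP (pvm_measure E x) (mF k)).
by apply: (etrans (pvm_measureE _ _)); rewrite F0 sqn0.
Qed.

End Projections.

Section Spectral.
Variables (R : realType) (I : choiceType).
Local Notation H := (l2 R I).
Local Notation RR := (measurableTypeR R).
Variables (T : {linear H -> H}) (E : projection_valued_measure R I RR).
Hypothesis hE : spectral_resolution T E.
Implicit Types (x y : H) (A B : set R).

Lemma spectral_real x : l2_inner (T x) x = ((rdot (T x) x)%:C)%C.
Proof. by rewrite /rdot; have [_ ->] := hE x. Qed.

(** Polarization: the quadratic form of [T] is real because it is the integral of a
    real function. *)
Lemma spectral_sym x y : rdot (T x) y = rdot x (T y).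
Proof.
have im u v : complex.Im (l2_inner (T u) v) = - complex.Im (l2_inner (T v) u).
  have := congr1 (@complex.Im R) (spectral_real (u + v)).
  rewrite linearD ipDl !ipDr !raddfD /= !spectral_real /=; lra.
rewrite [RHS]rdotC.
have := im ('i%C *: x) y; rewrite linearZ /= ipZl ipZr /rdot.
case: (l2_inner (T x) y) => a b; case: (l2_inner (T y) x) => c e /=; lra.
Qed.

(** The scalar measure of [E A x] is the restriction to [A] of that of [x]. *)
Lemma rdot_pvm A x : measurable (A : set RR) ->
  rdot (T (E A x)) (E A x) = \int[pvm_measure E x]_(t in A) (t : RR).
Proof.
move=> mA; have mA' := measurableC mA.
have [ix xE] := hE (E A x).
rewrite {1}/rdot xE /= -(setUv A) Rintegral_setU //; last 2 first.
- by rewrite setUv.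
- by apply/disj_setPS; rewrite setICr.
rewrite [X in _ + X](_ : _ = 0) ?addr0.
  rewrite /Rintegral; congr fine; apply: eq_measure_integral => B mB BA.
  by rewrite -[LHS]/(pvm_measure E _ B) -[RHS]/(pvm_measure E _ B) !pvm_measureE pvm_restrict.
rewrite /Rintegral null_set_integral //.
by apply: (etrans (pvm_measureE _ _ _)); rewrite pvm_disjoint ?setICl // sqn0.
Qed.

Lemma rdot_pvm_setC A x : measurable (A : set RR) ->
  rdot (T x) x = rdot (T (E A x)) (E A x) + rdot (T (E (~` A) x)) (E (~` A) x).
Proof.
move=> mA; have mA' := measurableC mA.
have [ix xE] := hE x.
rewrite {1}/rdot xE /= -(setUv A) Rintegral_setU //; last 2 first.
- by rewrite setUv.
- by apply/disj_setPS; rewrite setICr.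
by rewrite !rdot_pvm.
Qed.

(** By [rdot_pvm_setC] the quadratic form of [T] has no cross term between the
    ranges of [E A] and [E (~` A)]; symmetry turns this into orthogonality. *)
Lemma rdot_pvm_cross A x y : measurable (A : set RR) ->
  rdot (T (E A x)) (E (~` A) y) = 0.
Proof.
move=> mA; have mA' := measurableC mA.
have := rdot_pvm_setC (E A x + E (~` A) y) mA.
rewrite !linearD /= !pvm_idem !(pvm_disjoint _ _ mA mA') ?setICr //.
rewrite !(pvm_disjoint _ _ mA' mA) ?setICl // !linear0 !addr0 !add0r.
rewrite rdotDl !rdotDr (spectral_sym (E (~` A) y) (E A x)).
rewrite (rdotC (E (~` A) y) (T (E A x))). lra.
Qed.

(** Since [T] maps the range of [E A] into the orthogonal complement of the range
    of [E (~` A)], it preserves both ranges. *)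
Lemma spectral_comm A x : measurable (A : set RR) -> E A (T x) = T (E A x).
Proof.
move=> mA; have mA' := measurableC mA.
have off B y : measurable (B : set RR) -> E (~` B) (T (E B y)) = 0.
  move=> mB; apply: sqn_eq0.
  by rewrite pvm_sqn rdotC -pvm_idem -pvm_sym pvm_sym pvm_idem rdot_pvm_cross.
rewrite {1}(pvm_setC E x mA) !linearD /=.
have := off (~` A) x mA'; rewrite setCK => ->; rewrite addr0.
by rewrite [RHS](pvm_setC E _ mA) off // addr0.
Qed.

Lemma spectral_ge (b : R) A x : measurable (A : set RR) ->
  (forall t, A t -> b <= t) -> b * sqn (E A x) <= rdot (T (E A x)) (E A x).
Proof.
move=> mA bA; have [ix xE] := hE x.
rewrite rdot_pvm //.
rewrite [leLHS](_ : _ = \int[pvm_measure E x]_(t in A) b); last first.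
  by rewrite Rintegral_cst //; congr (_ * _); exact: (congr1 fine (esym (pvm_measureE E x A))).
apply: le_Rintegral => //.
- exact: finite_measure_integrable_cst.
- exact: (integrableS _ _ _ ix).
Qed.

Lemma spectral_le (b : R) A x : measurable (A : set RR) ->
  (forall t, A t -> t <= b) -> rdot (T (E A x)) (E A x) <= b * sqn (E A x).
Proof.
move=> mA bA; have [ix xE] := hE x.
rewrite rdot_pvm //.
rewrite [leRHS](_ : _ = \int[pvm_measure E x]_(t in A) b); last first.
  by rewrite Rintegral_cst //; congr (_ * _); exact: (congr1 fine (esym (pvm_measureE E x A))).
apply: le_Rintegral => //.
- exact: (integrableS _ _ _ ix).
- exact: finite_measure_integrable_cst.
Qed.

End Spectral.

(** * Intertwining operators and spectral subspaces *)

Section Intertwine.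
Variables (R : realType) (I : choiceType).
Local Notation H := (l2 R I).

Lemma geometric_eq0 (s r K : R) : 0 <= s -> 0 <= r -> r < 1 ->
  (forall n, s <= r ^+ n * K) -> s = 0.
Proof.
move=> s0 r0 r1 h; apply/eqP; rewrite eq_le s0 andbT.
have c : (fun n => r ^+ n * K) @ \oo --> 0 * K.
  by apply: cvgMr_tmp; apply: cvg_expr; rewrite ger0_norm.
rewrite mul0r in c; rewrite -(cvg_lim _ c) //.
apply: limr_ge; first by apply/cvg_ex; exists 0.
exact: nearW.
Qed.

(** Cauchy-Schwarz for the semi-inner product defined by a nonnegative operator. *)
Lemma nonneg_form_cs (S : {linear H -> H}) x y :
  (forall u v, rdot (S u) v = rdot u (S v)) ->
  (forall u, 0 <= rdot (S u) u) ->
  rdot (S x) y ^+ 2 <= rdot (S x) x * rdot (S y) y.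
Proof.
move=> sym pos; apply: nonneg_quadratic => // t.
rewrite (_ : _ + _ = rdot (S (t%:C%C *: x + y)) (t%:C%C *: x + y)) ?pos //.
rewrite linearD linearZ /= !rdotDl !rdotDr !rdotZl !rdotZr.
by rewrite (sym y x) (rdotC y); ring.
Qed.

(** Compare growth rates of iterates.  On the range of [P] the powers of [S1] grow
    at most like [a ^ n], on the range of [Q] those of [S2] grow at least like
    [b ^ n].  As [W] intertwines the two, the component [Q (W (P x))] would have to
    obey both bounds, which for [a < b] leaves only [0].  This replaces the
    uniqueness of the spectral resolution and any functional calculus. *)
Lemma intertwiner_vanish (S1 S2 P Q W : {linear H -> H}) (a b : R) x :
  0 <= a < b ->
  (forall u v, rdot (S1 u) v = rdot u (S1 v)) ->
  (forall u, 0 <= rdot (S1 u) u) ->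
  (forall u, W (S1 u) = S2 (W u)) ->
  (forall u, sqn (W u) <= sqn u) ->
  (forall u, P (P u) = P u) -> (forall u, P (S1 u) = S1 (P u)) ->
  (forall u, Q (Q u) = Q u) -> (forall u, Q (S2 u) = S2 (Q u)) ->
  (forall u, sqn (Q u) <= sqn u) ->
  (forall u, rdot (S1 (P u)) (P u) <= a * sqn (P u)) ->
  (forall u, b * sqn (Q u) <= rdot (S2 (Q u)) (Q u)) ->
  Q (W (P x)) = 0.
Proof.
move=> /andP[a0 ab] sym pos WS Wle PP PS QQ QS Qle Pa Qb.
have b0 : 0 < b by exact: le_lt_trans ab.
have up y : sqn (S1 (P y)) <= a ^+ 2 * sqn (P y).
  have cs := nonneg_form_cs (P y) (S1 (P y)) sym pos.
  have := Pa (S1 y); rewrite PS => h; rewrite -/(sqn (S1 (P y))) in cs.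
  have h2 := Pa y.
  have := le_trans cs (ler_pM (pos _) (pos _) h2 h).
  have [->|n0] := eqVneq (sqn (S1 (P y))) 0.
    by move=> _; rewrite mulr_ge0 ?sqr_ge0 ?sqn_ge0.
  have p0 : 0 < sqn (S1 (P y)) by rewrite lt_neqAle eq_sym n0 sqn_ge0.
  by rewrite (_ : a * _ * _ = (a ^+ 2 * sqn (P y)) * sqn (S1 (P y))) ?expr2 ?ler_pM2r //; ring.
have dn y : b ^+ 2 * sqn (Q y) <= sqn (S2 (Q y)).
  have h := le_trans (Qb y) (le_trans (ler_norm _) (cauchy_schwarz _ _)).
  rewrite -!l2norm_sq in h *.
  have [q0|n0] := eqVneq (l2norm (Q y)) 0.
    by rewrite q0 expr0n mulr0 sqr_ge0.
  have p0 : 0 < l2norm (Q y) by rewrite lt_neqAle eq_sym n0 l2norm_ge0.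
  move: h; rewrite expr2 mulrA ler_pM2r // => h.
  by rewrite -exprMn ler_pXn2r // nnegrE ?l2norm_ge0 // mulr_ge0 ?l2norm_ge0 // ltW.
have Q2 n y : b ^+ 2 ^+ n * sqn (Q y) <= sqn (Q (iter n S2 y)).
  elim: n => [|n IH] /=; first by rewrite expr0 mul1r.
  rewrite QS exprS -mulrA; apply: le_trans (dn _).
  by rewrite ler_wpM2l // sqr_ge0.
have P1 n : sqn (iter n S1 (P x)) <= a ^+ 2 ^+ n * sqn (P x).
  have Pn m : P (iter m S1 (P x)) = iter m S1 (P x).
    by elim: m => [|m IH] /=; [exact: PP | rewrite PS IH].
  elim: n => [|n IH] /=; first by rewrite expr0 mul1r.
  rewrite -Pn exprS -mulrA; apply: le_trans (up _) _.
  by rewrite ler_wpM2l ?sqr_ge0 // Pn.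
have Wn n y : W (iter n S1 y) = iter n S2 (W y).
  by elim: n => [|n IH] //=; rewrite WS IH.
apply: sqn_eq0; apply: (@geometric_eq0 _ (a ^+ 2 / b ^+ 2) (sqn (P x))).
- exact: sqn_ge0.
- by rewrite divr_ge0 ?sqr_ge0.
- by rewrite ltr_pdivrMr ?exprn_gt0 // mul1r ltr_pXn2r // nnegrE // ltW.
move=> n; rewrite expr_div_n mulrAC ler_pdivlMr ?exprn_gt0 // mulrC.
apply: le_trans (Q2 n _) _; rewrite -Wn.
by apply: le_trans (Qle _) _; apply: le_trans (Wle _) _; exact: P1.
Qed.

End Intertwine.

Section Shells.
Variable R : realType.
Local Notation RR := (measurableTypeR R).

(** Multiplying by a sign [s = 1] or [s = -1] treats both half-lines at once; the
    same device is used for [shell] and for the spectral bounds below. *)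
Lemma measurable_scaled_ge (s c : R) : measurable ([set t | c <= s * t] : set RR).
Proof.
rewrite (_ : mkset _ = (fun t : R => s * t) @^-1` `[c, +oo[%classic).
  rewrite -[X in measurable X]setTI.
  by apply: (@measurable_realfun.mulrl_measurable R setT s) => //; exact: measurable_itv.
by apply/seteqP; split => t /=; rewrite in_itv /= andbT.
Qed.

Definition shell (s beta : R) : set R := [set t | 0 < s * t <= beta].

Lemma measurable_shell s beta : measurable (shell s beta : set RR).
Proof.
rewrite (_ : shell s beta = [set t | - beta <= - s * t] `\` [set t | 0 <= - s * t]).
  by apply: measurableD; exact: measurable_scaled_ge.
apply/seteqP; split => t; rewrite /shell /= !mulNr lerN2 oppr_ge0.
  by move=> /andP[h1 h2]; split => //; apply/negP; rewrite -ltNge.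
by move=> [-> /negP]; rewrite -ltNge => ->.
Qed.

End Shells.

Section SpectralIntertwine.
Variables (R : realType) (I : choiceType).
Local Notation H := (l2 R I).
Local Notation RR := (measurableTypeR R).
Variables (T : {linear H -> H}) (E : projection_valued_measure R I RR).
Hypothesis hE : spectral_resolution T E.
Variable M : R.
Hypothesis TM : forall x, `|rdot (T x) x| <= M * sqn x.
Implicit Types (x y : H) (A B : set R).
Variable W : {linear H -> H}.
Hypothesis Wle : forall x, sqn (W x) <= sqn x.

Lemma spectral_scaled_le (s a : R) A x : s = 1 \/ s = -1 ->
  measurable (A : set RR) -> (forall t, A t -> s * t <= a) ->
  s * rdot (T (E A x)) (E A x) <= a * sqn (E A x).
Proof.
move=> [] -> mA h.
  by rewrite mul1r; apply: (spectral_le hE) => // t /h; rewrite mul1r.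
rewrite mulN1r lerNl -mulNr; apply: (spectral_ge hE) => // t /h.
by rewrite mulN1r lerNl.
Qed.

Lemma spectral_scaled_ge (s a : R) A x : s = 1 \/ s = -1 ->
  measurable (A : set RR) -> (forall t, A t -> a <= s * t) ->
  a * sqn (E A x) <= s * rdot (T (E A x)) (E A x).
Proof.
move=> hs mA h.
have := @spectral_scaled_le (- s) (- a) A x; rewrite !mulNr lerN2; apply => //.
  by case: hs => ->; rewrite ?opprK; [right|left].
by move=> t /h; rewrite mulNr lerN2.
Qed.

(** [intertwiner_vanish] for [s1 T + M'] and [s2 T + M'], with [M'] large enough to
    make the first operator nonnegative and the upper bound [a + M'] nonnegative. *)
Lemma spectral_separation (s1 s2 a b : R) A B x : s1 = 1 \/ s1 = -1 ->
  s2 = 1 \/ s2 = -1 ->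
  (forall y, (s1%:C)%C *: W (T y) = (s2%:C)%C *: T (W y)) ->
  measurable (A : set RR) -> measurable (B : set RR) ->
  (forall t, A t -> s1 * t <= a) -> (forall t, B t -> b <= s2 * t) -> a < b ->
  E B (W (E A x)) = 0.
Proof.
move=> h1 h2 hW mA mB Aa Bb ab.
have s1n : `|s1| = 1 by case: h1 => ->; rewrite ?normrN normr1.
pose M' := Num.max M `|a|.
have Ma : 0 <= a + M'.
  have : `|a| <= M' by rewrite /M' le_max lexx orbT.
  by have := ler_norm (- a); rewrite normrN; lra.
pose S s : {linear H -> H} := (s%:C%C \*: T) \+ (M'%:C%C \*: idfun).
have SE s y : S s y = s%:C%C *: T y + M'%:C%C *: y by [].
have rS s u v : rdot (S s u) v = s * rdot (T u) v + M' * rdot u v.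
  by rewrite SE rdotDl !rdotZl.
apply: (@intertwiner_vanish R I (S s1) (S s2) (E A) (E B) W (a + M') (b + M')).
- by rewrite Ma ltrD2r.
- by move=> u v; rewrite rS [RHS]rdotC rS (spectral_sym hE) rdotC (rdotC u).
- move=> u; rewrite rS; have := TM u => h.
  have : `|s1 * rdot (T u) u| <= M' * rdot u u.
    rewrite normrM s1n mul1r; apply: le_trans h _.
    by rewrite ler_wpM2r ?sqn_ge0 // le_max lexx.
  by rewrite ler_norml => /andP[]; lra.
- by move=> u; rewrite !SE linearD !linearZ /= hW.
- exact: Wle.
- exact: pvm_idem.
- by move=> u; rewrite !SE linearD !linearZ /= (spectral_comm hE).
- exact: pvm_idem.
- by move=> u; rewrite !SE linearD !linearZ /= (spectral_comm hE).
- exact: sqn_pvm_le.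
- move=> u; rewrite rS mulrDl lerD2r //.
  exact: spectral_scaled_le.
- move=> u; rewrite rS mulrDl lerD2r //.
  exact: spectral_scaled_ge.
Qed.

(** The set [B] is exhausted by its parts at distance at least [1 / (n + 1)] from
    the threshold, on which the separated case applies. *)
Lemma spectral_separation_strict (s1 s2 a : R) A B x : s1 = 1 \/ s1 = -1 ->
  s2 = 1 \/ s2 = -1 ->
  (forall y, (s1%:C)%C *: W (T y) = (s2%:C)%C *: T (W y)) ->
  measurable (A : set RR) -> measurable (B : set RR) ->
  (forall t, A t -> s1 * t <= a) -> (forall t, B t -> a < s2 * t) ->
  E B (W (E A x)) = 0.
Proof.
move=> h1 h2 hW mA mB Aa Bb.
pose F n : set RR := B `&` [set t | a + n.+1%:R^-1 <= s2 * t].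
have mF n : measurable (F n) by apply: measurableI => //; exact: measurable_scaled_ge.
have -> : B = \bigcup_n F n.
  apply/seteqP; split=> [t Bt|t [n _ []] //].
  have /ltr_add_invr [n hn] := Bb t Bt.
  by exists n => //; split => //=; exact: ltW.
apply: sqn_bigcup_eq0 => // n.
apply: (@spectral_separation s1 s2 a (a + n.+1%:R^-1)) => //; first by move=> t [].
by rewrite ltrDl invr_gt0.
Qed.


(** An intertwiner between [T] and [s T] cannot move spectral mass from outside
    [(0, eps)] into the shell, so the projection of [W x] on the shell only sees the
    part of [x] with spectrum in [(0, eps)].  With right translations this expresses
    that the spectral measure is a trace; with the sign of the cursor ([s = -1]) it
    expresses the symmetry of the spectrum about [0]. *)
Lemma sqn_shell_transport (s beta eps : R) x :
  s = 1 \/ s = -1 -> beta < eps ->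
  (forall y, W (T y) = (s%:C)%C *: T (W y)) ->
  sqn (E (shell s beta) (W x)) <= sqn (E `]0, eps[%classic x).
Proof.
move=> hs be hW; set J := shell s beta.
have mJ : measurable (J : set RR) by exact: measurable_shell.
have m0 : measurable (`]-oo, 0]%classic : set RR) by exact: measurable_itv.
have me : measurable (`[eps, +oo[%classic : set RR) by exact: measurable_itv.
have mo : measurable (`]0, eps[%classic : set RR) by exact: measurable_itv.
have s' : - s = 1 \/ - s = -1 by case: hs => ->; rewrite ?opprK; [right|left].
have E1 y : E J (W (E `]-oo, 0]%classic y)) = 0.
  apply: (@spectral_separation_strict 1 s 0); rewrite ?scale1r //; first by left.
  - by move=> z; rewrite rmorph1 scale1r.
  - by move=> t /=; rewrite in_itv /= mul1r.
  - by move=> t /andP[].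
have E2 y : E J (W (E `[eps, +oo[%classic y)) = 0.
  apply: (@spectral_separation (-1) (- s) (- eps) (- beta)) => //; first by right.
  - by move=> z; rewrite rmorphN1 scaleN1r rmorphN scaleNr hW.
  - by move=> t /=; rewrite in_itv /= andbT mulN1r lerN2.
  - by move=> t /andP[_]; rewrite mulNr lerN2.
  - by rewrite ltrN2.
have -> : E J (W x) = E J (W (E `]0, eps[%classic x)).
  rewrite [in LHS](pvm_setC E x m0) !linearD /= E1 add0r.
  rewrite [in LHS](pvm_setC E (E (~` _) x) me) !linearD /= E2 add0r.
  congr (E J (W _)); rewrite -pvm_setI; [|exact: measurableC|exact: measurableC].
  congr (E _ x); apply/seteqP; split => t /=; rewrite !in_itv /= andbT.
    by move=> [/negP h1 /negP h2]; rewrite !ltNge h2 h1.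
  by move=> /andP[h1 h2]; split; apply/negP; rewrite -ltNge.
by apply: le_trans (sqn_pvm_le _ _ _) _; exact: Wle.
Qed.

End SpectralIntertwine.

(** * Spectral mass of approximate kernel vectors in the range *)

Section TestVectors.
Variables (R : realType) (I : choiceType).
Local Notation H := (l2 R I).
Local Notation RR := (measurableTypeR R).
Variables (T : {linear H -> H}) (E : projection_valued_measure R I RR).
Hypothesis hE : spectral_resolution T E.
Implicit Types (x y : H).

(** The quadratic form of [T] vanishes identically on the range of [E [set 0]], and
    [T] preserves this range. *)
Lemma spectral_kernel x : T (E [set 0 : R] x) = 0.
Proof.
have m0 : measurable ([set 0] : set RR) by exact: measurable_set1.
have q0 y : rdot (T (E [set 0 : R] y)) (E [set 0 : R] y) = 0.
  have h1 := @spectral_le _ _ _ _ hE 0 [set 0] y m0 (fun t h => eq_ind_r (fun t => t <= 0) (lexx 0) h).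
  have h2 := @spectral_ge _ _ _ _ hE 0 [set 0] y m0 (fun t h => eq_ind_r (fun t => 0 <= t) (lexx 0) h).
  by apply/eqP; rewrite eq_le; move: h1 h2; rewrite mul0r => -> ->.
apply: sqn_eq0; rewrite /sqn -[in X in rdot _ X](spectral_comm hE) //.
have := q0 (x + T x); rewrite !linearD /= rdotDl !rdotDr !q0.
rewrite (spectral_sym hE (E _ (T x))) (rdotC (E _ (T x))); lra.
Qed.

Lemma spectral_tail (s beta : R) x : s = 1 \/ s = -1 -> 0 < beta ->
  beta ^+ 2 * sqn (E [set t | beta <= s * t] x) <= sqn (E [set t | beta <= s * t] (T x)).
Proof.
move=> hs b0; set A := mkset _.
have mA : measurable (A : set RR) by exact: measurable_scaled_ge.
rewrite (spectral_comm hE) //.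
have h : beta * sqn (E A x) <= s * rdot (T (E A x)) (E A x).
  exact: (spectral_scaled_ge hE).
have h2 : s * rdot (T (E A x)) (E A x) <= l2norm (T (E A x)) * l2norm (E A x).
  apply: le_trans (ler_norm _) _; rewrite normrM.
  rewrite (_ : `|s| = 1) ?mul1r ?cauchy_schwarz //.
  by case: hs => ->; rewrite ?normrN normr1.
have {h h2} h := le_trans h h2.
rewrite -!l2norm_sq in h *.
have [q0|n0] := eqVneq (l2norm (E A x)) 0; first by rewrite q0 expr0n mulr0 sqr_ge0.
have p0 : 0 < l2norm (E A x) by rewrite lt_neqAle eq_sym n0 l2norm_ge0.
move: h; rewrite expr2 mulrA ler_pM2r // => h.
by rewrite -exprMn ler_pXn2r // nnegrE ?l2norm_ge0 // mulr_ge0 ?l2norm_ge0 // ltW.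
Qed.

Lemma sqn_cover (A B C : set R) x : measurable (A : set RR) ->
  measurable (B : set RR) -> measurable (C : set RR) -> A `<=` B `|` C ->
  sqn (E A x) <= sqn (E B x) + sqn (E C x).
Proof.
move=> mA mB mC ABC; have mU := measurableU _ _ mB mC.
apply: le_trans (sqn_pvm_mono E x mA mU ABC) _.
have mD := measurableD mC mB.
have -> : B `|` C = B `|` (C `\` B).
  apply/seteqP; split => t /= [Bt|]; [by left| |by left|by move=> []; right].
  by move=> Ct; have [Bt|nBt] := pselect (B t); [left|right].
rewrite sqn_setU //; last by apply/seteqP; split => // t /= [? []].
by rewrite lerD2l sqn_pvm_mono //; exact: subDsetl.
Qed.

(** The real line is covered by the two tails, the two shells and the point [0].
    The tails of [v] are controlled by [T v].  The point [0] is harmless because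
    [E [set 0]] kills [T u]: a vector close to the range of [T] has almost no
    component in the kernel.  This is what excludes a possible atom at [0]. *)
Lemma sqn_shell_ge (beta : R) u v : 0 < beta ->
  sqn v - sqn (v - T u) - sqn (T v) / beta ^+ 2 <=
  sqn (E (shell 1 beta) v) + sqn (E (shell (-1) beta) v).
Proof.
move=> b0; pose A s : set R := [set t | beta <= s * t].
have mA s : measurable (A s : set RR) by exact: measurable_scaled_ge.
have m0 : measurable ([set 0] : set RR) by exact: measurable_set1.
have mS := measurable_shell.
have mS2 : measurable (shell 1 beta `|` shell (-1) beta : set RR) by exact: measurableU.
have mS3 : measurable ([set 0] `|` (shell 1 beta `|` shell (-1) beta) : set RR) by exact: measurableU.
have mA2 : measurable (A 1 `|` A (-1) : set RR) by exact: measurableU.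
have c1 : sqn v <= sqn (E (A 1 `|` A (-1)) v) +
    sqn (E ([set 0] `|` (shell 1 beta `|` shell (-1) beta)) v).
  rewrite -{1}(pvm_setT E v); apply: sqn_cover => // t _.
  rewrite /A /shell /= !mul1r !mulN1r.
  have [bt|tb] := leP beta t; first by left; left.
  have [bt|tb'] := leP beta (- t); first by left; right.
  right; have [t0|t0|->] := ltgtP t 0; last by left.
    by right; right; rewrite oppr_gt0 t0 ltW.
  by right; left; rewrite ltW.
have c2 : sqn (E ([set 0] `|` (shell 1 beta `|` shell (-1) beta)) v) <=
    sqn (E [set 0] v) + sqn (E (shell 1 beta `|` shell (-1) beta) v).
  exact: sqn_cover.
have c3 : sqn (E (shell 1 beta `|` shell (-1) beta) v) <=
    sqn (E (shell 1 beta) v) + sqn (E (shell (-1) beta) v).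
  exact: sqn_cover.
have k0 : sqn (E [set 0] v) <= sqn (v - T u).
  rewrite -[in leLHS](subrK (T u) v) linearD /= (spectral_comm hE) // spectral_kernel addr0.
  exact: sqn_pvm_le.
have A0 : A 1 `&` A (-1) = set0.
  apply/seteqP; split => t // [] /=; rewrite /A /= mul1r mulN1r => h1 h2; lra.
have tl : beta ^+ 2 * sqn (E (A 1 `|` A (-1)) v) <= sqn (T v).
  rewrite sqn_setU // mulrDr.
  apply: le_trans (sqn_pvm_le E (A 1 `|` A (-1)) (T v)).
  by rewrite sqn_setU // lerD //; apply: spectral_tail => //; [left | right].
have {tl} tl : sqn (E (A 1 `|` A (-1)) v) <= sqn (T v) / beta ^+ 2.
  by rewrite ler_pdivlMr ?exprn_gt0 // mulrC.
lra.
Qed.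

End TestVectors.

(** * Left multiplication and twisted right translations *)

Lemma sqnE (R : realType) (I : choiceType) (x : l2 R I) :
  sqn x = fine (\esum_(i in [set: I]) (normc (x i) ^+ 2)%:E)%E.
Proof. by rewrite /sqn /rdot ip_diag. Qed.

Section LeftMul.
Variables (R : realType) (G : groupType).
Local Notation C := R[i].
Local Notation H := (l2 R G).
Local Notation CG := (group_algebra C G).
Implicit Types (x y : H) (g h : G) (a b : CG).

Lemma translateE g x h : translate g x h = x (g^-1 * h)%g.
Proof. by []. Qed.

Lemma translate_is_linear g : linear (translate g : H -> H).
Proof. by move=> c x y; apply: l2P => h. Qed.
HB.instance Definition _ g :=
  GRing.isLinear.Build C H H _ (translate g : H -> H) (translate_is_linear g).

Lemma translateM g h x : translate g (translate h x) = translate (g * h)%g x.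
Proof. by apply: l2P => k; rewrite !translateE invgM mulgA. Qed.

Lemma translate1 x : translate 1%g x = x.
Proof. by apply: l2P => k; rewrite translateE invg1 mul1g. Qed.

Lemma translate_delta g h : translate g (l2_delta R h) = l2_delta R (g * h)%g.
Proof.
by apply: l2P => k; rewrite translateE /= -(inj_eq (mulgI g)) mulVKg.
Qed.

Lemma sqn_translate g x : sqn (translate g x) = sqn x.
Proof.
rewrite !sqnE [in RHS](reindex_esum [set: G] [set: G] (fun h => g^-1 * h)%g) //.
split=> // [h1 h2 _ _ /mulgI//|h _].
by exists (g * h)%g => //; rewrite mulKg.
Qed.

Lemma l2norm_translate g x : l2norm (translate g x) = l2norm x.
Proof. by rewrite /l2norm sqn_translate. Qed.

Lemma left_mulw (d : {fset G}) a x : (msupp a `<=` d)%fset ->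
  left_mul a x = \sum_(h <- d) mcoeff h a *: translate h x.
Proof.
move=> le_d; rewrite /left_mul; apply: (big_fset_incl _ le_d) => h _ /mcoeff_outdom ->.
by rewrite scale0r.
Qed.

Lemma left_mul_is_linear a : linear (left_mul a : H -> H).
Proof.
move=> c x y; rewrite /left_mul scaler_sumr -big_split /=; apply: eq_bigr => h _.
by rewrite linearP scalerDr !scalerA mulrC.
Qed.
HB.instance Definition _ a :=
  GRing.isLinear.Build C H H _ (left_mul a : H -> H) (left_mul_is_linear a).

Lemma left_mulD a b x : left_mul (a + b) x = left_mul a x + left_mul b x.
Proof.
rewrite (@left_mulw (msupp a `|` msupp b)%fset (a + b)) ?msuppD_le //.
rewrite (@left_mulw (msupp a `|` msupp b)%fset a) ?fsubsetUl //.
rewrite (@left_mulw (msupp a `|` msupp b)%fset b) ?fsubsetUr //.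
by rewrite -big_split /=; apply: eq_bigr => h _; rewrite mcoeffD scalerDl.
Qed.

Lemma left_mul0 x : left_mul (0 : CG) x = 0.
Proof. by rewrite /left_mul msupp0 big_seq_fset0. Qed.

Lemma left_mul_sum (T : Type) (s : seq T) (F : T -> CG) x :
  left_mul (\sum_(t <- s) F t) x = \sum_(t <- s) left_mul (F t) x.
Proof.
exact: (big_morph (fun a : CG => left_mul a x) (fun _ _ => left_mulD _ _ _) (left_mul0 x)).
Qed.

(** The product of [group_algebra] is defined by sums taken in [malg G C]. *)
Lemma left_mul_msum (T : Type) (s : seq T) (F : T -> malg G C) x :
  left_mul (\sum_(t <- s) F t) x = \sum_(t <- s) left_mul (F t) x.
Proof. exact: left_mul_sum. Qed.

Lemma left_mulU g (c : C) x : left_mul (mkmalgU g c : CG) x = c *: translate g x.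
Proof. by rewrite (@left_mulw [fset g]%fset) ?msuppU_le // big_seq_fset1 mcoeffUU. Qed.

Lemma left_mul_galg g x : left_mul (galg_of C g) x = translate g x.
Proof. by rewrite left_mulU scale1r. Qed.

Lemma left_mulM a b x : left_mul (a * b) x = left_mul a (left_mul b x).
Proof.
transitivity (left_mul (galg_mul a b) x) => //.
rewrite left_mul_msum {3}/left_mul; apply: eq_bigr => g _.
rewrite left_mul_msum linear_sum scaler_sumr; apply: eq_bigr => h _.
by rewrite left_mulU linearZ /= translateM scalerA.
Qed.

Lemma left_mul_nat n x : left_mul (n%:R : CG) x = n%:R *: x.
Proof.
elim: n => [|n IH]; first by rewrite left_mul0 scale0r.
by rewrite !mulrSr left_mulD IH left_mul_galg translate1 scalerDl scale1r.
Qed.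

Variables (c : G -> C) (c1 : forall g, normc (c g) = 1).

Lemma twist_subproof g x :
  (fun h => c h * x (h * g)%g) \in @square_summable_pred R G.
Proof.
have /asboolP := l2_prop x; rewrite /square_summable.
rewrite (reindex_esum [set: G] [set: G] (fun h => h * g)%g) => [sx|].
  apply/asboolP; rewrite /square_summable; under eq_esum do rewrite normcM c1 mul1r.
  exact: sx.
split=> // [h1 h2 _ _ /mulIg//|h _].
by exists (h * g^-1)%g => //; rewrite mulgVK.
Qed.

(** Right translation by [g] followed by multiplication by a function of modulus
    one.  For a character [c] of the group these operators commute with left
    translations up to the scalar [c]. *)
Definition twist g x : H := L2 (twist_subproof g x).

Lemma twist_is_linear g : linear (twist g).
Proof. by move=> z x y; apply: l2P => h /=; rewrite mulrDr; congr (_ + _); exact: mulrCA. Qed.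
HB.instance Definition _ g :=
  GRing.isLinear.Build C H H _ (twist g) (twist_is_linear g).

Lemma sqn_twist g x : sqn (twist g x) = sqn x.
Proof.
rewrite !sqnE [in RHS](reindex_esum [set: G] [set: G] (fun h => h * g)%g) //.
  by congr fine; apply: eq_esum => h _ /=; rewrite normcM c1 mul1r.
split=> // [h1 h2 _ _ /mulIg//|h _].
by exists (h * g^-1)%g => //; rewrite mulgVK.
Qed.

Lemma twist_delta g : twist g (l2_delta R 1%g) = c g^-1%g *: l2_delta R g^-1%g.
Proof.
apply: l2P => h; rewrite l2Z /=; have [->|n] := eqVneq h g^-1%g.
  by rewrite mulVg eqxx.
rewrite (negbTE (_ : (h * g != 1)%g)) ?mulr0 //.
by apply: contraNneq n => /(canRL (mulgK _)); rewrite mul1g => ->.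
Qed.

Lemma translate_twist (h g : G) z x : (forall k, c k = z * c (h^-1 * k)%g) ->
  twist g (translate h x) = z *: translate h (twist g x).
Proof.
by move=> ch; apply: l2P => k; rewrite l2Z !translateE /= ch !mulgA mulrA.
Qed.

End LeftMul.

(** * The operator T *)

Section HoppingOperator.
Variables (R : realType) (G : groupType) (s : 'I_3 -> G) (t : G).
Local Notation C := R[i].
Local Notation H := (l2 R G).
Implicit Types (x y : H).

(** Left multiplication by [p = s_1 + s_1^-1 + s_2 + s_2^-1 + s_3 + s_3^-1 + 7]. *)
Definition lampop x : H :=
  \sum_(i < 3) (translate (s i) x + translate (s i)^-1%g x) + 7%:R *: x.

Lemma lampop_is_linear : linear lampop.
Proof.
move=> c x y; rewrite /lampop [in RHS]scalerDr [in RHS]scaler_sumr addrACA -big_split /=.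
congr (_ + _); last by rewrite scalerDr !scalerA mulrC.
by apply: eq_bigr => i _; rewrite !linearP /= scalerDr addrACA.
Qed.
HB.instance Definition _ := GRing.isLinear.Build C H H _ lampop lampop_is_linear.

Let u (g : G) : group_algebra C G := galg_of C g.
Let p : group_algebra C G := \sum_(i < 3) (u (s i) + u (s i)^-1%g) + 7%:R.

Lemma left_mul_hopping x : left_mul (p * u t + u t^-1%g * p) x =
  lampop (translate t x) + translate t^-1%g (lampop x).
Proof.
have lp y : left_mul p y = lampop y.
  rewrite left_mulD left_mul_sum left_mul_nat; congr (_ + _).
  by apply: eq_bigr => i _; rewrite left_mulD !left_mul_galg.
by rewrite left_mulD (left_mulM p) (left_mulM (u t^-1%g)) lp lp (left_mul_galg t)
  (left_mul_galg t^-1%g).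
Qed.

Lemma l2norm_lampop x : l2norm (lampop x) <= 13 * l2norm x.
Proof.
rewrite /lampop; set a := \sum_(i < 3) _; set b := _ *: x.
apply: le_trans (l2normD a b) _; rewrite l2normZ.
have -> : normc (7%:R : C) = 7.
  by rewrite normcMn normc1.
have : l2norm (\sum_(i < 3) (translate (s i) x + translate (s i)^-1%g x)) <= 6 * l2norm x.
  apply: le_trans (l2norm_sum _ _ _) _.
  apply: (@le_trans _ _ (\sum_(i < 3) 2 * l2norm x)).
    apply: ler_sum => i _; apply: le_trans (l2normD _ _) _.
    by rewrite !l2norm_translate mulr2n mulrDl mul1r.
  rewrite !big_ord_recl big_ord0; lra.
lra.
Qed.

Lemma left_mul_hopping_bounded x : `|rdot (left_mul (p * u t + u t^-1%g * p) x) x| <= 26 * sqn x.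
Proof.
apply: le_trans (cauchy_schwarz _ _) _; rewrite -l2norm_sq expr2 mulrA.
apply: ler_wpM2r; first exact: l2norm_ge0.
rewrite left_mul_hopping; apply: le_trans (l2normD _ _) _; rewrite l2norm_translate.
have := l2norm_lampop (translate t x); rewrite l2norm_translate.
have := l2norm_lampop x; lra.
Qed.

End HoppingOperator.

Section Lamplighter.
Variable R : realType.
Local Notation C := R[i].
Local Notation G := Z3wrZ.
Local Notation H := (l2 R G).
Local Notation TC := (Z3wrZ_T C).
Local Notation lampop := (@lampop R Z3wrZ Z3wrZ_s).
Implicit Types (x y : H) (g h : G).

Lemma left_mul_T x : left_mul TC x =
  lampop (translate Z3wrZ_t x) + translate Z3wrZ_t^-1%g (lampop x).
Proof. exact: left_mul_hopping. Qed.

Lemma left_mul_T_bounded x : `|rdot (left_mul TC x) x| <= 26 * sqn x.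
Proof. exact: left_mul_hopping_bounded. Qed.

(** For [s = -1] this is the parity of the cursor; it anticommutes with [T] since
    every term of [T] moves the cursor by one. *)
Definition cursor_char (s : R) (g : G) : C := ((s%:C)%C : C) ^ cursor g.

Section Sign.
Variables (s : R) (hs : s = 1 \/ s = -1).

Lemma cursor_char_norm g : normc (cursor_char s g) = 1.
Proof.
have n1 : normc ((s%:C)%C : C) = 1.
  by rewrite /normc /= expr0n addr0 sqrtr_sqr; case: hs => ->; rewrite ?normrN normr1.
have nX n : normc (((s%:C)%C : C) ^+ n) = 1.
  by elim: n => [|n IH]; rewrite ?normc1 // exprS normcM n1 IH mulr1.
by rewrite /cursor_char; case: (cursor g) => n /=; rewrite ?normcV nX ?invr1.
Qed.

Local Notation W := (twist cursor_char_norm).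

Lemma cursor_charM (h g : G) : cursor_char s g = cursor_char s h * cursor_char s (h^-1 * g)%g.
Proof.
have s0 : (s%:C)%C != 0 :> C.
  by rewrite (fmorph_eq0 (real_complex R)); case: hs => ->; rewrite ?oppr_eq0 oner_eq0.
by rewrite /cursor_char -expfzDr //; congr (_ ^ _); rewrite /= addrA subrr add0r.
Qed.

Lemma twist_T g x : W g (left_mul TC x) = (s%:C)%C *: left_mul TC (W g x).
Proof.
have tr h y : W g (translate h y) = cursor_char s h *: translate h (W g y).
  exact/translate_twist/cursor_charM.
have cs i : cursor_char s (Z3wrZ_s i) = 1 by rewrite /cursor_char /= expr0z.
have cs' i : cursor_char s (Z3wrZ_s i)^-1%g = 1 by rewrite /cursor_char /= oppr0 expr0z.
have ct : cursor_char s Z3wrZ_t = (s%:C)%C by rewrite /cursor_char /= expr1z.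
have ct' : cursor_char s Z3wrZ_t^-1%g = (s%:C)%C.
  rewrite /cursor_char /= exprN1 -(fmorphV (real_complex R)) /=.
  by case: hs => ->; rewrite ?invrN invr1.
have lp y : W g (lampop y) = lampop (W g y).
  rewrite /lampop linearD linear_sum linearZ /=; congr (_ + _).
  by apply: eq_bigr => i _; rewrite linearD /= !tr cs cs' !scale1r.
rewrite !left_mul_T [LHS]linearD /= lp !tr ct ct' lp scalerDr; congr (_ + _).
exact: linearZ.
Qed.

End Sign.

Variable E : projection_valued_measure R G (measurableTypeR R).
Hypothesis hE : spectral_resolution (left_mul TC) E.

(** All delta functions carry the same spectral mass, and the shells on both sides
    of [0] carry the same mass: [l2_delta g] is, up to a scalar of modulus one, the
    image of [l2_delta 1] by a twisted right translation that commutes or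
    anticommutes with [T]. *)
Lemma sqn_shell_delta (s beta eps : R) g : s = 1 \/ s = -1 -> beta < eps ->
  sqn (E (shell s beta) (l2_delta R g)) <= sqn (E `]0, eps[%classic (l2_delta R (1%g : G))).
Proof.
move=> hs be.
have Wle x : sqn (twist (cursor_char_norm hs) g^-1%g x) <= sqn x by rewrite sqn_twist.
have := sqn_shell_transport (T := left_mul TC) hE left_mul_T_bounded Wle
  (l2_delta R (1%g : G)) hs be (twist_T hs g^-1%g).
by rewrite /= twist_delta linearZ /= sqnZ (cursor_char_norm hs) expr1n mul1r invgK.
Qed.

Lemma spectral_measureE (A : set R) :
  spectral_measure E A = (sqn (E A (l2_delta R (1%g : G))))%:E.
Proof. by rewrite /spectral_measure pvm_sqn. Qed.

End Lamplighter.

(** * Combinations of delta functions *)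

Section Orthonormal.
Variables (R : realType) (I : choiceType).
Local Notation H := (l2 R I).

Lemma sqn_sum_delta (J : finType) (P : pred J) (g : J -> I) (a : J -> R[i]) :
  {in P &, injective g} ->
  sqn (\sum_(j | P j) a j *: l2_delta R (g j)) = \sum_(j | P j) normc (a j) ^+ 2.
Proof.
move=> ginj; apply: complexI; rewrite -ip_sqn ip_suml rmorph_sum /=.
apply: eq_bigr => j Pj; rewrite ip_sumr (bigD1 j) //= [X in _ + X]big1 ?addr0.
  by rewrite ipZl ipZr ip_delta /= eqxx mulr1 -sqr_normc rmorphXn.
move=> k /andP[Pk kj]; rewrite ipZl ipZr ip_delta /=.
rewrite (negbTE (_ : g k != g j)) ?mulr0 //.
by apply: contraNneq kj => /ginj ->.
Qed.

Lemma sqnB_le (x y : H) : sqn (x - y) <= 2 * sqn x + 2 * sqn y.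
Proof. by rewrite sqnB; have := sqn_ge0 (x + y); rewrite sqnD; lra. Qed.

(** Only the terms where [g] and [h] differ survive, and each of the two remaining
    sums has orthonormal terms with unimodular coefficients. *)
Lemma sqn_move_deltas (J : finType) (P : pred J) (g h : J -> I) (a : J -> R[i]) :
  injective g -> injective h -> (forall j, ~~ P j -> g j = h j) ->
  (forall j, normc (a j) = 1) ->
  sqn (\sum_j a j *: l2_delta R (g j) - \sum_j a j *: l2_delta R (h j)) <= 4 * #|P|%:R.
Proof.
move=> ginj hinj gh a1.
rewrite (bigID P) /= [X in _ - X](bigID P) /=.
rewrite [X in (_ + X) - _](eq_bigr (fun j => a j *: l2_delta R (h j))); last first.
  by move=> j nPj; rewrite gh.
rewrite opprD addrACA subrr addr0.
apply: (le_trans (sqnB_le _ _)).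
rewrite sqn_sum_delta; last by move=> i j _ _; exact: ginj.
rewrite sqn_sum_delta; last by move=> i j _ _; exact: hinj.
have -> : \sum_(j | P j) normc (a j) ^+ 2 = #|P|%:R.
  by under eq_bigr do rewrite a1 expr1n; rewrite sumr_const.
lra.
Qed.
End Orthonormal.

(** * Lamp configurations relative to the cursor *)

Section Sites.
Variable m : nat.
Local Notation D := ('I_m * 'I_3)%type.
Local Notation A := 'rV[int]_3.

Definition lamp_config (z : D -> int) : malg int A :=
  \sum_(j < m) mkmalgU (j%:Z) (\row_i z (j, i)).

Lemma mcoeff_lamp_config z (j : 'I_m) :
  mcoeff (j%:Z) (lamp_config z) = \row_i z (j, i).
Proof.
rewrite /lamp_config raddf_sum /= (bigD1 j) //= mcoeffUU big1 ?addr0 // => k kj.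
by rewrite mcoeffU eqz_nat (negbTE (_ : k != j :> nat)).
Qed.

Lemma lamp_config_inj z z' : lamp_config z = lamp_config z' -> z =1 z'.
Proof.
move=> e [j i]; have := congr1 (mcoeff (j%:Z)) e; rewrite !mcoeff_lamp_config.
by move=> /rowP /(_ i); rewrite !mxE.
Qed.

Definition incr_lamp (z : D -> int) (d : D) : D -> int := fun e => z e + (e == d)%:R.

Lemma lamp_config_incr z (j : 'I_m) i :
  mkmalgU (j%:Z) (delta_mx 0 i) + lamp_config z = lamp_config (incr_lamp z (j, i)).
Proof.
rewrite /lamp_config (bigD1 j) //= [in RHS](bigD1 j) //= addrA; congr (_ + _).
  rewrite -monalgUD; congr mkmalgU; apply/rowP => k.
  by rewrite !mxE /incr_lamp addrC xpair_eqE eqxx /= eqxx.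
apply: eq_bigr => k kj; congr mkmalgU; apply/rowP => l.
by rewrite !mxE /incr_lamp xpair_eqE (negbTE kj) addr0.
Qed.

(** Lamp configurations are recorded relative to the cursor, at position [- n].  In
    these coordinates left multiplication by [t] only changes [n], while left
    multiplication by [s_i] changes only the lamp with index [n]; see [siteS] and
    [site_incr]. *)
Definition site (z : D -> int) (n : nat) : Z3wrZ :=
  WreathZ (Defs.shift (- n%:Z) (lamp_config z)) (- n%:Z).

Lemma site_inj n z z' : site z n = site z' n -> z =1 z'.
Proof.
move=> /(congr1 (@lamps _)) /= /(congr1 (Defs.shift n%:Z)).
by rewrite !Defs.shift_shift subrr !Defs.shift0 => /lamp_config_inj.
Qed.

Lemma site_cursor_inj n n' z z' : site z n = site z' n' -> n = n'.
Proof. by move=> /(congr1 (@cursor _)) /= /oppr_inj []. Qed.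

Lemma siteS z n : (Z3wrZ_t * site z n.+1)%g = site z n.
Proof.
transitivity (WreathZ (0 + Defs.shift 1 (Defs.shift (- n.+1%:Z) (lamp_config z))) (1 - n.+1%:Z)) => //.
rewrite /site add0r Defs.shift_shift.
by rewrite (_ : 1 - n.+1%:Z = - n%:Z) //; lia.
Qed.

Lemma site_incr z (j : 'I_m) i : (Z3wrZ_s i * site z j)%g = site (incr_lamp z (j, i)) j.
Proof.
transitivity (WreathZ (mkmalgU 0 (delta_mx 0 i) +
  Defs.shift 0 (Defs.shift (- j%:Z) (lamp_config z))) (0 - j%:Z)) => //.
rewrite /site add0r Defs.shift0 -lamp_config_incr raddfD /=.
congr (WreathZ (_ + _) _); apply/malgP => k.
rewrite mcoeff_shift !mcoeffU opprK.
by rewrite -[in RHS](inj_eq (addIr (- j%:Z))) addrK subrr.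
Qed.

End Sites.

(** * Waves: truncated characters of the lamp group *)

Lemma normc1_neq0 (R : realType) (y : R[i]) : normc y = 1 -> y != 0.
Proof. by move=> y1; apply: contra_eqN y1 => /eqP ->; rewrite normc0 eq_sym oner_eq0. Qed.

Lemma normc1_inv (R : realType) (y : R[i]) : normc y = 1 -> y^-1 = (y^*)%C.
Proof.
move=> y1; apply: (mulfI (normc1_neq0 y1)).
by rewrite mulfV ?normc1_neq0 // -sqr_normc /Num.norm /= y1 expr1n.
Qed.

Section ApproximateEigenvector.
Variables (R : realType) (G : groupType).
Local Notation C := R[i].
Local Notation H := (l2 R G).

Lemma l2norm_translateV_sub (g : G) (y : C) (x : H) : normc y = 1 ->
  l2norm (translate g^-1%g x - y *: x) = l2norm (translate g x - y^-1 *: x).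
Proof.
move=> y1; rewrite -(l2norm_translate g) linearB linearZ /= translateM mulgV translate1.
rewrite (_ : x - _ = - (y *: (translate g x - y^-1 *: x))).
  by rewrite l2normN l2normZ y1 mul1r.
by rewrite scalerBr scalerA mulfV ?normc1_neq0 // scale1r opprB.
Qed.

(** If the translations by [s i] act on [x] almost as the scalars [(y i)^-1], their
    sum acts almost as the real number [7 + sum_i (y i + (y i)^-1)]. *)
Lemma lampop_approx_eigen (s : 'I_3 -> G) (y : 'I_3 -> C) (x : H) (e : R) :
  (forall i, normc (y i) = 1) ->
  (forall i, l2norm (translate (s i) x - (y i)^-1 *: x) <= e) ->
  l2norm (lampop s x - ((7 + \sum_(i < 3) 2 * complex.Re (y i))%:C)%C *: x) <= 6 * e.
Proof.
move=> ny h1.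
have h2 i : l2norm (translate (s i)^-1%g x - y i *: x) <= e by rewrite l2norm_translateV_sub.
have [e1 e1E] : {e1 : 'I_3 -> H | forall i, e1 i = translate (s i) x - (y i)^-1 *: x}.
  by exists (fun i => translate (s i) x - (y i)^-1 *: x).
have [e2 e2E] : {e2 : 'I_3 -> H | forall i, e2 i = translate (s i)^-1%g x - y i *: x}.
  by exists (fun i => translate (s i)^-1%g x - y i *: x).
have {}h1 i : l2norm (e1 i) <= e by rewrite e1E.
have {}h2 i : l2norm (e2 i) <= e by rewrite e2E.
rewrite (_ : _ - _ = \sum_(i < 3) (e1 i + e2 i)).
  apply: le_trans (l2norm_sum _ _ _) _; rewrite !big_ord_recl big_ord0.
  have h i : l2norm (e1 i + e2 i) <= 2 * e.
    apply: (le_trans (l2normD _ _)); apply: (le_trans (lerD (h1 i) (h2 i))).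
    by rewrite mulr2n mulrDl mul1r.
  rewrite addr0; apply: (le_trans (lerD (h _) (lerD (h _) (h _)))).
  by rewrite le_eqVlt; apply/orP; left; apply/eqP; ring.
under [in RHS]eq_bigr do rewrite e1E e2E addrACA -opprD -scalerDl.
rewrite sumrB -scaler_suml /lampop -addrA; congr (_ + _).
rewrite -scalerBl -scaleNr; congr (_ *: _).
rewrite rmorphD /= opprD addrA rmorph_nat subrr add0r; congr (- _).
rewrite rmorph_sum /=; apply: eq_bigr => i _.
by rewrite normc1_inv // addrC addcJ rmorphM rmorph_nat.
Qed.

End ApproximateEigenvector.

Section WaveVectors.
Variables (R : realType) (m N : nat) (z : R[i]).
Hypothesis zN : N.-primitive_root z.
Local Notation C := R[i].
Local Notation H := (l2 R Z3wrZ).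
Local Notation D := ('I_m * 'I_3)%type.
Local Notation cfg := {ffun D -> 'I_N}.
Implicit Types (th c : cfg) (d : D).

Let N0 : (0 < N)%N := prim_order_gt0 zN.

Lemma root_norm : normc z = 1.
Proof.
have h : normc z ^+ N = 1.
  have nX n : normc (z ^+ n) = normc z ^+ n.
    by elim: n => [|n IH]; rewrite ?normc1 // !exprS normcM IH.
  by rewrite -nX (prim_expr_order zN) normc1.
by apply/eqP; rewrite -(pexpr_eq1 N0 (normc_ge0 z)) h.
Qed.

Lemma root_normX n : normc (z ^+ n) = 1.
Proof. by elim: n => [|n IH]; rewrite ?normc1 // exprS normcM IH root_norm mulr1. Qed.

(** The characters of the finite group [(Z/N)^D], for [D] the set of lamp
    coordinates; both characters and group elements are functions [D -> 'I_N]. *)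
Definition chi th c : C := \prod_d z ^+ (th d * c d).
Definition int_config c : D -> int := fun d => (c d : nat)%:Z.
(** The character [th] cut off to a cube of [N ^ (3 m)] lamp configurations, at
    cursor [- n].  On these vectors [p] acts almost as multiplication by a weight, up
    to an error of relative size [N ^ (-1/2)] coming from the faces of the cube. *)
Definition wave th n : H := \sum_c chi th c *: l2_delta R (site (int_config c) n).
Definition volume : R := #|{: cfg}|%:R.

Lemma chi_norm th c : normc (chi th c) = 1.
Proof.
rewrite /chi; elim/big_rec : _ => [|d y _ IH]; first exact: normc1.
by rewrite normcM IH root_normX mulr1.
Qed.

Lemma int_config_inj n : injective (fun c => site (int_config c) n).
Proof.
move=> c c' /site_inj e; apply/ffunP => d; apply: val_inj.
by have := e d; rewrite /int_config => -[].
Qed.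

Lemma volume_gt0 : 0 < volume.
Proof.
rewrite /volume ltr0n; apply/card_gt0P.
by exists [ffun _ => Ordinal N0].
Qed.

Lemma sqn_wave th n : sqn (wave th n) = volume.
Proof.
rewrite /wave (sqn_sum_delta _ (g := fun c => site (int_config c) n)); last first.
  by move=> c c' _ _; exact: int_config_inj.
under eq_bigr do rewrite chi_norm expr1n.
by rewrite sumr_const.
Qed.

Lemma ip_wave th n n' : n != n' -> l2_inner (wave th n) (wave th n') = 0.
Proof.
move=> nn; rewrite /wave ip_suml big1 // => c _; rewrite ip_sumr big1 // => c' _.
rewrite ipZl ipZr ip_delta /= (negbTE (_ : site _ n' != site _ n)) ?mulr0 //.
by apply: contraNneq nn => /site_cursor_inj ->.
Qed.

Lemma translate_wave th n : translate Z3wrZ_t (wave th n.+1) = wave th n.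
Proof.
rewrite /wave linear_sum; apply: eq_bigr => c _.
by rewrite linearZ /= translate_delta siteS.
Qed.

Lemma translateV_wave th n : translate Z3wrZ_t^-1%g (wave th n) = wave th n.+1.
Proof. by rewrite -translate_wave translateM mulVg translate1. Qed.

Definition last_in d : pred cfg := fun c => (c d).+1 == N.

(** Adding one to coordinate [d] leaves the cube exactly on this face. *)
Lemma card_last_in d : N%:R * (#|last_in d|)%:R = volume.
Proof.
have Np : (N.-1 < N)%N by rewrite prednK.
pose F (e : D) (k : 'I_N) : nat := if e == d then nat_of_bool (k == Ordinal Np) else 1%N.
have E1 : #|last_in d| = (\sum_(c : cfg) \prod_e F e (c e))%N.
  rewrite -sum1_card big_mkcond /=; apply: eq_bigr => c _.
  rewrite (bigD1 d) //= big1 => [|e /negbTE ed]; last by rewrite /F ed.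
  rewrite muln1 /F eqxx -val_eqE /= /last_in unfold_in.
  rewrite (_ : ((c d).+1 == N) = (nat_of_ord (c d) == N.-1)); first by case: eqP.
  by move: N0 (nat_of_ord (c d)) => N0' k; apply/eqP/eqP; lia.
rewrite /volume -natrM; congr (_%:R); rewrite E1 -(bigA_distr_bigA F).
have E2 e : (\sum_k F e k = if e == d then 1 else N)%N.
  rewrite /F; case: eqP => _; last by rewrite sum1_card card_ord.
  by rewrite -big_mkcond /= big_pred1_eq.
under eq_bigr do rewrite E2.
rewrite (bigD1 d) //= eqxx mul1n card_ffun card_ord.
rewrite (eq_bigr (fun=> N)) => [|e /negbTE ->] //.
rewrite prod_nat_const -expnS; congr (_ ^ _)%N.
by rewrite [RHS](cardD1 d) inE add1n; congr _.+1; apply: eq_card => e; rewrite !inE andbT.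
Qed.

(** Cyclic successor in coordinate [d]: the version of the shift that preserves the
    cube, for which characters are exact eigenvectors. *)
Definition next_in d c : cfg := [ffun e => if e == d then ordS (c e) else c e].

Lemma next_in_inj d : injective (next_in d).
Proof.
move=> c c' /ffunP h; apply/ffunP => e; have := h e; rewrite !ffunE.
by case: eqP => // _ /ordS_inj.
Qed.

Lemma chi_next th d c : chi th (next_in d c) = z ^+ th d * chi th c.
Proof.
rewrite /chi (bigD1 d) //= [in RHS](bigD1 d) //= mulrA; congr (_ * _).
  rewrite ffunE eqxx /= !exprM -exprS.
  by rewrite expr_mod // -exprM mulnC exprM (prim_expr_order zN) expr1n.
by apply: eq_bigr => e /negbTE ed; rewrite ffunE ed.
Qed.

Lemma int_config_next d c : ~~ last_in d c -> int_config (next_in d c) = incr_lamp (int_config c) d.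
Proof.
rewrite /last_in => h; apply/funext => e; rewrite /int_config /incr_lamp ffunE.
case: eqP => [->|_] /=; last by rewrite addr0.
rewrite modn_small; first by rewrite -addn1 PoszD.
by rewrite ltn_neqAle h ltn_ord.
Qed.

(** The true shift and the cyclic one agree off a face of the cube, which contains a
    fraction [1 / N] of its points. *)
Lemma wave_shift_err th (j : 'I_m) i :
  sqn (translate (Z3wrZ_s i) (wave th j) - (z ^+ th (j, i))^-1 *: wave th j)
  <= 4 * volume / N%:R.
Proof.
set d := (j, i).
have z0 : z ^+ th d != 0 by rewrite normc1_neq0 // root_normX.
have -> : translate (Z3wrZ_s i) (wave th j) =
    \sum_c chi th c *: l2_delta R (site (incr_lamp (int_config c) d) j).
  rewrite /wave linear_sum; apply: eq_bigr => c _.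
  by rewrite linearZ /= translate_delta site_incr.
have -> : (z ^+ th d)^-1 *: wave th j =
    \sum_c chi th c *: l2_delta R (site (int_config (next_in d c)) j).
  rewrite /wave scaler_sumr (reindex_inj (@next_in_inj d)) /=; apply: eq_bigr => c _.
  by rewrite scalerA chi_next mulKf.
have N0' : N%:R != 0 :> R by rewrite pnatr_eq0 -lt0n.
have -> : 4 * volume / N%:R = 4 * #|last_in d|%:R by rewrite -(card_last_in d); field.
apply: sqn_move_deltas => [c c'|c c'|c h|c]; last exact: chi_norm.
- move=> /site_inj e; apply/ffunP => d'; apply: val_inj.
  by have := e d'; rewrite /incr_lamp /int_config => e'; have := addIr _ e'; case.
- by move=> /int_config_inj /next_in_inj.
- by rewrite int_config_next.
Qed.

Definition weight th (j : 'I_m) : R := 7 + \sum_(i < 3) 2 * complex.Re (z ^+ th (j, i)).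

Definition wave_error : R := Num.sqrt (4 * volume / N%:R).

Lemma lampop_wave th (j : 'I_m) :
  l2norm (lampop Z3wrZ_s (wave th j) - (weight th j)%:C%C *: wave th j) <= 6 * wave_error.
Proof.
apply: lampop_approx_eigen => i; first exact: root_normX.
by rewrite /l2norm /wave_error ler_wsqrtr // wave_shift_err.
Qed.

End WaveVectors.

(** * Packets of waves and Jacobi matrices *)

Section Hopping.
Variables (R : realType) (G : groupType) (s : 'I_3 -> G) (t : G).
Local Notation H := (l2 R G).

Lemma hopping_approx (a b c : H) (w1 w2 : R[i]) (e : R) :
  translate t b = a -> translate t^-1%g b = c ->
  l2norm (lampop s a - w1 *: a) <= e -> l2norm (lampop s b - w2 *: b) <= e ->
  l2norm (lampop s (translate t b) + translate t^-1%g (lampop s b) - (w1 *: a + w2 *: c))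
    <= 2 * e.
Proof.
move=> ta tc ha hb; rewrite ta -tc opprD addrACA -linearZ -linearB /=.
apply: (le_trans (l2normD _ _)); rewrite l2norm_translate mulr2n mulrDl mul1r.
exact: lerD.
Qed.
End Hopping.

Section HilbertSums.
Variables (R : realType) (I : choiceType).
Local Notation H := (l2 R I).

Lemma sqn_orthogonal_sum n (a : 'I_n -> R) (x : 'I_n -> H) (V : R) :
  (forall i, sqn (x i) = V) ->
  (forall i j, i != j -> l2_inner (x i) (x j) = 0) ->
  sqn (\sum_i (a i)%:C%C *: x i) = V * \sum_i a i ^+ 2.
Proof.
move=> xV x0; apply: complexI; rewrite -ip_sqn ip_suml rmorphM rmorph_sum mulr_sumr /=.
apply: eq_bigr => i _; rewrite ip_sumr (bigD1 i) //= [X in _ + X]big1 ?addr0.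
  by rewrite ipZl ipZr ip_sqn xV conjc_real -!rmorphM /= mulrA mulrC -expr2.
by move=> j ji; rewrite ipZl ipZr x0 ?mulr0 // eq_sym.
Qed.

(** With [y] the combination, the sum of [sqn (x i - a i *: y)] is nonnegative and
    equals the right-hand side minus [sqn y]. *)
Lemma sqn_unit_combination n (a : 'I_n -> R) (x : 'I_n -> H) :
  \sum_i a i ^+ 2 = 1 ->
  sqn (\sum_i (a i)%:C%C *: x i) <= \sum_i sqn (x i).
Proof.
move=> a1; set y := \sum_i _.
have h : 0 <= \sum_i sqn (x i - (a i)%:C%C *: y) by apply: sumr_ge0 => i _; exact: sqn_ge0.
have e : \sum_i sqn (x i - (a i)%:C%C *: y) = \sum_i sqn (x i) - sqn y.
  have yy : sqn y = \sum_i a i * rdot (x i) y.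
    rewrite {1}/sqn {1}/y /rdot ip_suml raddf_sum /=; apply: eq_bigr => i _.
    by rewrite -[LHS]/(rdot _ y) rdotZl.
  have sz i : sqn ((a i)%:C%C *: y) = a i ^+ 2 * sqn y.
    by rewrite /sqn rdotZl rdotZr mulrA expr2.
  under eq_bigr do rewrite sqnB rdotZr sz.
  by rewrite big_split /= -mulr_suml a1 mul1r sumrB -mulr_sumr -yy; ring.
by move: h; rewrite e subr_ge0.
Qed.

(** The Jacobi matrix on the half-line with zero diagonal and weight [w n] on the
    edge between [n] and [n + 1]. *)
Definition jacobi (w phi : nat -> R) (n : nat) : R :=
  w n * phi n.+1 + (if n is p.+1 then w p * phi p else 0).

(** If [T] acts on the vectors [b n] almost as the Jacobi matrix with weights [w],
    then so it does on their combinations, provided the coefficients vanish at the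
    ends, where nothing is known about [T (b n)]. *)
Lemma jacobi_packet (T : {linear H -> H}) (m : nat) (b : nat -> H)
    (w phi : nat -> R) (e : R) :
  0 <= e -> phi 0%N = 0 -> (forall n, (m <= n)%N -> phi n = 0) ->
  (forall k, (k.+1 < m)%N ->
     l2norm (T (b k.+1) - ((w k)%:C%C *: b k + (w k.+1)%:C%C *: b k.+2)) <= e) ->
  l2norm (T (\sum_(n < m.+1) (phi n)%:C%C *: b n)
     - \sum_(n < m.+1) (jacobi w phi n)%:C%C *: b n) <=
  e * \sum_(n < m.+1) `|phi n|.
Proof.
move=> e0 phi0 phim hT.
pose a k := (w k)%:C%C *: b k + (w k.+1)%:C%C *: b k.+2.
have eJ : \sum_(n < m.+1) (jacobi w phi n)%:C%C *: b n = \sum_(k < m) (phi k.+1)%:C%C *: a k.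
  under eq_bigr do rewrite /jacobi rmorphD scalerDl.
  rewrite big_split /=.
  under [RHS]eq_bigr do rewrite /a scalerDr !scalerA -!rmorphM /=.
  rewrite [RHS]big_split /=; congr (_ + _).
    rewrite big_ord_recr /= phim // mulr0 scale0r addr0.
    by apply: eq_bigr => k _; rewrite mulrC.
  rewrite big_ord_recl /= scale0r add0r.
  transitivity (\sum_(k < m.+1) (w k * phi k)%:C%C *: b k.+1).
    rewrite [RHS]big_ord_recr /= phim // mulr0 scale0r addr0.
    by apply: eq_bigr.
  rewrite big_ord_recl /= phi0 mulr0 scale0r add0r.
  by apply: eq_bigr => k _; rewrite mulrC.
rewrite eJ big_ord_recl /= phi0 scale0r add0r linear_sum -sumrB.
apply: (le_trans (l2norm_sum _ _ _)).
rewrite big_ord_recl phi0 normr0 add0r mulr_sumr; apply: ler_sum => k _.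
rewrite linearZ /= -scalerBr l2normZ.
have nr (r : R) : normc (r%:C%C) = `|r|.
  by rewrite /normc /= expr0n addr0 sqrtr_sqr.
rewrite nr /bump /= add1n mulrC.
have [km|mk] := ltnP k.+1 m; last by rewrite phim // normr0 !mulr0.
by apply: ler_wpM2r; [exact: normr_ge0 | exact: hT].
Qed.

(** Invariance of the trace of [F^* F] under a change of orthogonal basis. *)
Lemma sum_sqn_unitary (J K : finType) (F : {linear H -> H}) (chi : J -> K -> R[i])
    (x : K -> H) (V : R) :
  (forall c c', \sum_j chi j c * ((chi j c')^*)%C = (V * (c == c')%:R)%:C%C) ->
  \sum_j sqn (F (\sum_c chi j c *: x c)) = V * \sum_c sqn (F (x c)).
Proof.
move=> orth; apply: complexI; rewrite rmorphM !rmorph_sum /=.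
under eq_bigr do rewrite linear_sum -ip_sqn ip_suml.
under eq_bigr do under eq_bigr do rewrite ip_sumr.
rewrite exchange_big mulr_sumr /=; apply: eq_bigr => c _.
rewrite exchange_big (bigD1 c) //= [X in _ + X]big1 ?addr0.
  under eq_bigr do rewrite !linearZ /= ipZl ipZr mulrA.
  by rewrite -mulr_suml orth eqxx mulr1 ip_sqn.
move=> c' cc'; under eq_bigr do rewrite !linearZ /= ipZl ipZr mulrA.
by rewrite -mulr_suml orth eq_sym (negbTE cc') mulr0 mul0r.
Qed.

End HilbertSums.

Section Packets.
Variables (R : realType) (m N : nat) (z : R[i]).
Hypothesis zN : N.-primitive_root z.
Local Notation C := R[i].
Local Notation H := (l2 R Z3wrZ).
Local Notation D := ('I_m * 'I_3)%type.
Local Notation cfg := {ffun D -> 'I_N}.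
Local Notation TC := (Z3wrZ_T C).
Local Notation wave := (@wave R m N z).
Local Notation volume := (@volume R m N).
Local Notation wave_error := (@wave_error R m N).
Local Notation weight := (@weight R m N z).
Implicit Types (th c : cfg) (d : D).

Lemma left_mul_T_wave th (w : nat -> R) k : (forall j : 'I_m, w j = weight th j) ->
  (k.+1 < m)%N ->
  l2norm (left_mul TC (wave th k.+1) -
    ((w k)%:C%C *: wave th k + (w k.+1)%:C%C *: wave th k.+2)) <= 12 * wave_error.
Proof.
move=> hw km; have k'm := ltnW km.
have h1 := lampop_wave zN th (Ordinal k'm); rewrite -hw /= in h1.
have h2 := lampop_wave zN th (Ordinal km); rewrite -hw /= in h2.
rewrite left_mul_T (_ : 12 * wave_error = 2 * (6 * wave_error)); last by ring.
apply: hopping_approx => //; first exact: translate_wave.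
exact: translateV_wave.
Qed.

Lemma chi_orthogonal c c' :
  \sum_th chi z th c * ((chi z th c')^*)%C = (volume * (c == c')%:R)%:C%C.
Proof.
have N0 := prim_order_gt0 zN.
pose y d : C := z ^+ c d * ((z ^+ c' d)^*)%C.
have E th : chi z th c * ((chi z th c')^*)%C = \prod_d y d ^+ th d.
  rewrite /chi rmorph_prod -big_split /=; apply: eq_bigr => d _.
  by rewrite /y exprMn -exprM -rmorphXn /= -exprM !(mulnC (th d)).
under eq_bigr do rewrite E.
rewrite -(bigA_distr_bigA (fun d (k : 'I_N) => y d ^+ k)).
have G d : \sum_(k < N) y d ^+ k = N%:R * (c d == c' d)%:R.
  have n1 : normc (z ^+ c' d) = 1 by exact: (root_normX zN).
  have yE : y d = z ^+ c d / z ^+ c' d by rewrite /y normc1_inv.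
  case: eqP => [e|ne].
    rewrite mulr1 (eq_bigr (fun=> 1)); first by rewrite sumr_const card_ord.
    by move=> k _; rewrite yE e divff ?normc1_neq0 // expr1n.
  rewrite mulr0; have y1 : y d - 1 != 0.
    rewrite subr_eq0 yE; apply/negP => /eqP /(canRL (mulfVK (normc1_neq0 n1))).
    rewrite mul1r => /eqP; rewrite (eq_prim_root_expr zN) !modn_small // => /eqP.
    by move/val_inj.
  apply: (mulfI y1); rewrite mulr0 -subrX1.
  rewrite yE expr_div_n -!exprM !(mulnC _ N) !exprM (prim_expr_order zN) !expr1n.
  by rewrite divr1 subrr.
under eq_bigr do rewrite G.
rewrite rmorphM /= rmorph_nat /volume rmorph_nat card_ffun card_ord.
have [->|ne] := eqVneq c c'.
  rewrite mulr1 (eq_bigr (fun=> N%:R)); first by rewrite prodr_const natrX.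
  by move=> d _; rewrite eqxx mulr1.
have [d cd] : exists d, c d != c' d.
  apply/existsP; rewrite -negb_forall; apply: contra ne => /forallP h.
  by apply/eqP/ffunP => d; exact/eqP.
by rewrite mulr0 (bigD1 d) //= (negbTE cd) mulr0 mul0r.
Qed.

(** The total mass of the waves is the total mass of the delta functions of the
    cube, since the character table is unitary up to a factor. *)
Lemma sum_sqn_wave (F : {linear H -> H}) n :
  \sum_(th : cfg) sqn (F (wave th n)) =
  volume * \sum_(c : cfg) sqn (F (l2_delta R (site (int_config c) n))).
Proof. exact/sum_sqn_unitary/chi_orthogonal. Qed.

Lemma sqn_packet th (phi : nat -> R) :
  sqn (\sum_(n < m.+1) (phi n)%:C%C *: wave th n) = volume * \sum_(n < m.+1) phi n ^+ 2.
Proof.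
apply: (sqn_orthogonal_sum (fun n : 'I_m.+1 => phi n) (x := fun n : 'I_m.+1 => wave th n)).
  by move=> n; exact: sqn_wave.
by move=> n n' nn; apply: ip_wave; rewrite (inj_eq val_inj).
Qed.

Variable E : projection_valued_measure R Z3wrZ (measurableTypeR R).
Hypothesis hE : spectral_resolution (left_mul TC) E.
Variables (beta eps K : R).
Hypotheses (b0 : 0 < beta) (b1 : beta <= 1) (be : beta < eps).
Hypotheses (K0 : 0 <= K) (hN : 9216 * K ^+ 2 <= beta ^+ 2 * N%:R).

Let tau := sqn (E `]0, eps[%classic (l2_delta R (1%g : Z3wrZ))).

(** A unit vector [phi] that the Jacobi matrix almost kills, and that lies in the
    range of this matrix, namely it is the image of [u].  The last condition bounds the
    error made when [phi] and [u] are transported to [l2]. *)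
Definition near_zero_mode (w : nat -> R) : Prop := exists phi u : nat -> R,
  [/\ \sum_(n < m.+1) phi n ^+ 2 = 1,
      [/\ phi 0%N = 0, u 0%N = 0 & forall n, (m <= n)%N -> phi n = 0 /\ u n = 0],
      (forall n, (n < m.+1)%N -> jacobi w u n = phi n),
      \sum_(n < m.+1) jacobi w phi n ^+ 2 <= (beta / 4) ^+ 2 &
      \sum_(n < m.+1) `|phi n| <= K /\ \sum_(n < m.+1) `|u n| <= K].

Lemma near_zero_mode_sqn th (w : nat -> R) : (forall j : 'I_m, w j = weight th j) ->
  near_zero_mode w ->
  volume / 2 <= \sum_(n < m.+1) (sqn (E (shell 1 beta) (wave th n))
     + sqn (E (shell (-1) beta) (wave th n))).
Proof.
move=> hw [phi [u [phi1 [phi0 u0 phum] Ju Jphi [phiK uK]]]].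
have N0 : (0 < N)%N := prim_order_gt0 zN.
have N0R : 0 < N%:R :> R by rewrite ltr0n.
have V0 := volume_gt0 m zN.
have e0 : 0 <= 12 * wave_error by rewrite mulr_ge0 // sqrtr_ge0.
have step k : (k.+1 < m)%N -> l2norm (left_mul TC (wave th k.+1) -
    ((w k)%:C%C *: wave th k + (w k.+1)%:C%C *: wave th k.+2)) <= 12 * wave_error.
  exact: left_mul_T_wave.
have hphi := jacobi_packet e0 phi0 (fun n h => (phum n h).1) step.
have hu := jacobi_packet e0 u0 (fun n h => (phum n h).2) step.
have JuE : \sum_(n < m.+1) (jacobi w u n)%:C%C *: wave th n =
    \sum_(n < m.+1) (phi n)%:C%C *: wave th n.
  by apply: eq_bigr => n _; rewrite Ju.
rewrite JuE in hu.
(* 9216 = 16 * 24 ^ 2, where 24 = 12 * 2 and the error is 2 * sqrt (volume / N) *)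
have sq12 : (12 * wave_error * K) ^+ 2 <= beta ^+ 2 * (volume / 16).
  rewrite !exprMn sqr_sqrtr; last by rewrite divr_ge0 // mulr_ge0 // ltW.
  rewrite (_ : _ * _ * K ^+ 2 = (9216 * K ^+ 2 / N%:R) * (volume / 16)); last first.
    by field; rewrite gt_eqF.
  rewrite ler_wpM2r //; first by rewrite divr_ge0 // ltW.
  by rewrite ler_pdivrMr.
set v := \sum_(n < m.+1) (phi n)%:C%C *: wave th n in hphi hu.
set x := \sum_(n < m.+1) (u n)%:C%C *: wave th n in hu.
set y := \sum_(n < m.+1) (jacobi w phi n)%:C%C *: wave th n in hphi.
have vV : sqn v = volume by rewrite sqn_packet phi1 mulr1.
have yV : sqn y <= beta ^+ 2 * (volume / 16).
  rewrite sqn_packet; apply: (le_trans (ler_wpM2l (ltW V0) Jphi)).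
  by rewrite le_eqVlt; apply/orP; left; apply/eqP; field.
have xV : sqn (v - left_mul TC x) <= beta ^+ 2 * (volume / 16).
  apply: le_trans sq12; rewrite -sqnN opprB -l2norm_le; last by rewrite mulr_ge0.
  by apply: (le_trans hu); rewrite ler_wpM2l.
have TvV : sqn (left_mul TC v) <= beta ^+ 2 * (volume / 4).
  rewrite -(subrK y (left_mul TC v)).
  have d : sqn (left_mul TC v - y) <= beta ^+ 2 * (volume / 16).
    apply: le_trans sq12; rewrite -l2norm_le; last by rewrite mulr_ge0.
    by apply: (le_trans hphi); rewrite ler_wpM2l.
  have := sqnB_le (left_mul TC v - y) (- y); rewrite opprK sqnN; lra.
have key := sqn_shell_ge (T := left_mul TC) hE x v b0.
have lo : volume / 2 <= sqn (E (shell 1 beta) v) + sqn (E (shell (-1) beta) v).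
  apply: le_trans key; rewrite vV.
  have : sqn (left_mul TC v) / beta ^+ 2 <= volume / 4.
    by rewrite ler_pdivrMr ?exprn_gt0 // mulrC.
  have : beta ^+ 2 * (volume / 16) <= volume / 16.
    by apply: ler_piMl; rewrite ?divr_ge0 ?exprn_ile1 // ltW.
  lra.
have up s : sqn (E (shell s beta) v) <= \sum_(n < m.+1) sqn (E (shell s beta) (wave th n)).
  rewrite /v linear_sum.
  under eq_bigr do rewrite linearZ /=.
  exact: (sqn_unit_combination (a := fun n : 'I_m.+1 => phi n)
     (fun n : 'I_m.+1 => E (shell s beta) (wave th n))).
rewrite big_split /=; apply: (le_trans lo); apply: lerD; exact: up.
Qed.

(** Each good character provides a unit combination of its [m + 1] waves whose mass
    in the two shells is at least one half, hence at least as much total mass of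
    these waves.  Summing over characters compares the number of good characters
    with [m + 1] times the total mass of delta functions. *)
Lemma near_zero_mode_count (S : {set cfg}) (w : cfg -> nat -> R) :
  (forall th (j : 'I_m), w th j = weight th j) ->
  (forall th, th \in S -> near_zero_mode (w th)) ->
  #|S|%:R <= 4 * m.+1%:R * volume * tau.
Proof.
move=> hw hS; have V0 := volume_gt0 m zN.
have h1 : #|S|%:R * (volume / 2) <= \sum_(th : cfg) \sum_(n < m.+1)
    (sqn (E (shell 1 beta) (wave th n)) + sqn (E (shell (-1) beta) (wave th n))).
  rewrite -sum1_card natr_sum mulr_suml big_mkcond /=; apply: ler_sum => th _.
  case: ifP => [thS|_]; first by rewrite mul1r; apply: near_zero_mode_sqn (hw th) (hS _ thS).
  by apply: sumr_ge0 => n _; rewrite addr_ge0 ?sqn_ge0.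
have h2 s : s = 1 \/ s = -1 -> forall n, \sum_(th : cfg) sqn (E (shell s beta) (wave th n)) <=
    volume * (volume * tau).
  move=> hs n; rewrite sum_sqn_wave; apply: ler_wpM2l; first exact: ltW.
  apply: (@le_trans _ _ (\sum_(c : cfg) tau)).
    by apply: ler_sum => c _; exact: sqn_shell_delta.
  by rewrite sumr_const -mulr_natl; exact: lexx.
have h3 : #|S|%:R * (volume / 2) <= m.+1%:R * (2 * (volume * (volume * tau))).
  apply: (le_trans h1); rewrite exchange_big /=.
  apply: (@le_trans _ _ (\sum_(n < m.+1) 2 * (volume * (volume * tau)))).
    apply: ler_sum => n _; rewrite big_split /= mulr2n mulrDl mul1r.
    by apply: lerD; apply: h2; [left|right].
  by rewrite sumr_const card_ord -[X in X <= _]mulr_natl; exact: lexx.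
have V2 : 0 < volume / 2 by rewrite divr_gt0.
rewrite -(ler_pM2r V2).
apply: (le_trans h3); rewrite le_eqVlt; apply/orP; left; apply/eqP.
by field.
Qed.

End Packets.

(** * Approximate zero modes of Jacobi matrices *)

Section ZeroMode.
Variables (R : realType) (n : nat) (w : nat -> R) (eta : R).
Hypotheses (w1 : forall k, 1 <= w k) (w13 : forall k, w k <= 13).

(** Up to signs, the solution at the odd sites [2 k + 1] of the equation
    [jacobi w phi = 0] at the even sites, normalized to be [1] at [k = 0].  It is the
    exponential of a walk with steps [ln w_(2i+1) - ln w_(2i+2)]. *)
Definition ratio (k : nat) : R := \prod_(i < k) (w (i.*2).+1 / w (i.*2).+2).

Let wp k : 0 < w k. Proof. exact: lt_le_trans ltr01 (w1 k). Qed.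
Let wn0 k : w k != 0. Proof. by rewrite gt_eqF. Qed.

Lemma ratioS k : ratio k.+1 * w (k.*2).+2 = ratio k * w (k.*2).+1.
Proof. by rewrite /ratio big_ord_recr /= -mulrA divfK. Qed.

Lemma ratio_gt0 k : 0 < ratio k.
Proof. by rewrite /ratio; apply: prodr_gt0 => i _; rewrite divr_gt0. Qed.

Lemma ratio_le k : ratio k <= 13 ^+ k.
Proof.
elim: k => [|k IH]; first by rewrite /ratio big_ord0.
rewrite exprS mulrC /ratio big_ord_recr /=; apply: ler_pM => //.
- exact: ltW (ratio_gt0 k).
- by rewrite divr_ge0 // ltW.
- by rewrite ler_pdivrMr //; apply: (le_trans (w13 _)); rewrite ler_peMr.
Qed.

Lemma ratio_ge k : 1 <= ratio k * 13 ^+ k.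
Proof.
elim: k => [|k IH]; first by rewrite /ratio big_ord0 mulr1.
rewrite exprS /ratio big_ord_recr /=
  (_ : _ * _ * _ = (ratio k * 13 ^+ k) * (13 * (w (k.*2).+1 / w (k.*2).+2))).
  rewrite -[leLHS]mulr1; apply: ler_pM => //.
  rewrite mulrA ler_pdivlMr // mul1r; apply: (le_trans (w13 _)).
  by rewrite ler_peMr.
by rewrite /ratio; ring.
Qed.

Let Z1 := \sum_(0 <= k < n.*2.+1) ratio k ^+ 2.
Let Z2 := \sum_(n.*2.+1 <= k < (n.*2.*2).+1) ratio k ^+ 2.

(** The solution [ratio] is cut into two bumps, [k <= 2 n] and [2 n < k <= 4 n], which
    receive opposite multiples chosen so that the sum of
    [bump_height k * ratio k ^ 2] vanishes.  This is orthogonality to the solution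
    itself, the condition for being in the range of the Jacobi matrix. *)
Definition bump_height (k : nat) : R :=
  if (k <= n.*2)%N then Z2 else if (k <= n.*2.*2)%N then - Z1 else 0.

Definition primitive (k : nat) : R := \sum_(0 <= j < k) bump_height j * ratio j ^+ 2.

Definition mode (p : nat) : R :=
  if odd p then (-1) ^+ p./2 * ratio p./2 * bump_height p./2 else 0.

(** A preimage of [mode] supported at the even sites.  It is found by summing from
    the left, and vanishes to the right of the bumps because the total sum does. *)
Definition premode (p : nat) : R :=
  if odd p then 0 else - (-1) ^+ p./2 * primitive p./2 / (w p * ratio p./2).

Let r0 k : ratio k != 0. Proof. by rewrite gt_eqF // ratio_gt0. Qed.

Lemma jacobi_premode p : jacobi w premode p = mode p.
Proof.
rewrite /jacobi /premode /mode; case: p => [|p] /=.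
  by rewrite mulr0 addr0.
rewrite negbK; case: (boolP (odd p)) => op /=; first by rewrite !mulr0 addr0.
have pE : p = (p./2).*2 by rewrite -[LHS]odd_double_half (negbTE op).
have uE : uphalf p = p./2 by rewrite uphalf_half (negbTE op).
rewrite uE; set k := p./2 in pE uE *; rewrite pE.
have -> : primitive k.+1 = primitive k + bump_height k * ratio k ^+ 2.
  by rewrite /primitive big_nat_recr.
have wrS : w k.*2.+2 * ratio k.+1 = ratio k * w k.*2.+1 by rewrite mulrC ratioS.
by rewrite wrS exprS; field; rewrite r0 !wn0.
Qed.

(** [ratio] solves the equation, so only the jumps of [bump_height] contribute. *)
Lemma jacobi_mode_even k : jacobi w mode k.*2.+2 =
  (-1) ^+ k * w k.*2.+1 * ratio k * (bump_height k - bump_height k.+1).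
Proof.
rewrite /jacobi /mode /= !negbK !odd_double /= ?doubleK ?uphalf_double.
have wrS : ratio k.+1 * w k.*2.+2 = ratio k * w k.*2.+1 by exact: ratioS.
rewrite exprS (_ : w k.*2.+2 * _ = - (-1) ^+ k * (ratio k.+1 * w k.*2.+2) * bump_height k.+1).
  by rewrite wrS; ring.
by ring.
Qed.

Lemma jacobi_mode_odd k : jacobi w mode k.*2.+1 = 0.
Proof. by rewrite /jacobi /mode /= !odd_double /= !mulr0 addr0. Qed.

Lemma jacobi_mode0 : jacobi w mode 0 = w 0 * bump_height 0.
Proof. by rewrite /jacobi /mode /= expr0 /ratio big_ord0 !mul1r addr0. Qed.

Lemma sum_parity (F : nat -> R) M :
  \sum_(p < M.*2.+1) F p = F 0%N + \sum_(k < M) (F k.*2.+1 + F k.*2.+2).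
Proof.
elim: M => [|M IH]; first by rewrite big_ord_recl !big_ord0.
by rewrite doubleS 2!big_ord_recr /= IH [in RHS]big_ord_recr /= !addrA.
Qed.

Lemma bump_heightE1 k : (k <= n.*2)%N -> bump_height k = Z2.
Proof. by rewrite /bump_height => ->. Qed.

Lemma bump_heightE2 k : (n.*2 < k <= n.*2.*2)%N -> bump_height k = - Z1.
Proof. by move=> /andP[h1 h2]; rewrite /bump_height leqNgt h1 /= h2. Qed.

Lemma bump_heightE3 k : (n.*2.*2 < k)%N -> bump_height k = 0.
Proof.
move=> h; rewrite /bump_height.
have -> : (k <= n.*2)%N = false by lia.
by have -> : (k <= n.*2.*2)%N = false by lia.
Qed.

Let S := Z1 * Z2 ^+ 2 + Z2 * Z1 ^+ 2.

Let n24 : (n.*2.+1 <= (n.*2.*2).+1)%N.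
Proof. lia. Qed.

Lemma sum_mode : \sum_(p < (n.*2.*2).+1.*2.+1) mode p ^+ 2 = S.
Proof.
rewrite (sum_parity (fun p => mode p ^+ 2)) {1}/mode /= expr0n add0r.
under eq_bigr => k _.
  rewrite (_ : mode k.*2.+2 = 0); last by rewrite /mode /= negbK odd_double.
  rewrite expr0n addr0 /mode /= odd_double /= uphalf_double !exprMn sqrr_sign mul1r.
  over.
rewrite -(big_mkord xpredT (fun k => ratio k ^+ 2 * bump_height k ^+ 2)).
rewrite (big_cat_nat (n := n.*2.+1)) //= /S; congr (_ + _).
  rewrite mulr_suml; apply: eq_big_nat => k /andP[_ h].
  by rewrite bump_heightE1.
rewrite mulr_suml; apply: eq_big_nat => k h.
by rewrite bump_heightE2 ?sqrrN.
Qed.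

(** [bump_height] jumps at the left end, between the bumps and at the right end. *)
Lemma sum_jacobi_mode : (0 < n)%N ->
  \sum_(p < (n.*2.*2).+1.*2.+1) jacobi w mode p ^+ 2 =
  w 0%N ^+ 2 * Z2 ^+ 2 + (w n.*2.*2.+1 * ratio n.*2) ^+ 2 * (Z1 + Z2) ^+ 2
  + (w n.*2.*2.*2.+1 * ratio n.*2.*2) ^+ 2 * Z1 ^+ 2.
Proof.
move=> n0; rewrite (sum_parity (fun p => jacobi w mode p ^+ 2)) jacobi_mode0.
rewrite bump_heightE1 // exprMn -addrA; congr (_ + _).
under eq_bigr => k _.
  rewrite jacobi_mode_odd expr0n add0r jacobi_mode_even -!mulrA exprMn sqrr_sign mul1r.
  over.
have lt24 : (n.*2 < n.*2.*2)%N by lia.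
rewrite big_ord_recr /= bump_heightE2 ?leqnn ?lt24 // bump_heightE3 //.
rewrite (bigD1 (Ordinal lt24)) //= big1 ?addr0.
  rewrite bump_heightE1 // bump_heightE2 ?ltnSn // opprK !mulrA !exprMn (addrC Z2).
  by ring.
move=> k kn; suff -> : bump_height k = bump_height k.+1 by rewrite subrr !mulr0 expr0n.
have kn' : (k : nat) != n.*2 by exact: kn.
have := ltn_ord k; move: kn'; rewrite neq_ltn => /orP[h|h] hk.
  by rewrite !bump_heightE1 // ltnW.
by rewrite !bump_heightE2 // ?h ?(ltnW hk) // (ltn_trans h).
Qed.

Let nn1 : (n <= n.*2)%N. Proof. clear; lia. Qed.
Let nn2 : (n.*2 <= n.*2)%N. Proof. by []. Qed.

Let Z1ge1 : 1 <= Z1.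
Proof.
rewrite /Z1 big_nat_recl // {1}/ratio big_ord0 expr1n lerDl.
by apply: sumr_ge0 => k _; exact: sqr_ge0.
Qed.

Let Z1ge k : (k <= n.*2)%N -> ratio k ^+ 2 <= Z1.
Proof.
move=> kn; rewrite /Z1 big_mkord (bigD1 (Ordinal (kn : (k < n.*2.+1)%N))) //= lerDl.
by apply: sumr_ge0 => i _; exact: sqr_ge0.
Qed.

Let Z2ge k : (n.*2 < k <= n.*2.*2)%N -> ratio k ^+ 2 <= Z2.
Proof.
move=> /andP[k1 k2]; rewrite /Z2 (big_cat_nat (n := k)) //=; last by lia.
rewrite [X in _ + X]big_ltn ?ltnS // addrCA lerDl addr_ge0 //.
  by apply: sumr_ge0 => i _; exact: sqr_ge0.
by apply: sumr_ge0 => i _; exact: sqr_ge0.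
Qed.

Hypotheses (n0 : (0 < n)%N) (eta0 : 0 <= eta).
Hypotheses (up1 : 1 <= eta * ratio n) (down1 : ratio n.*2 <= eta * ratio n).
Hypotheses (up2 : ratio n.*2 <= eta * ratio (n.*2 + n)).
Hypothesis down2 : ratio n.*2.*2 <= eta * ratio (n.*2 + n).

Let nn3 : (n.*2 < n.*2 + n <= n.*2.*2)%N. Proof. move: n0; clear; lia. Qed.

Let Z2gt0 : 0 < Z2.
Proof.
apply: lt_le_trans (Z2ge (k := n.*2.+1) _); first by rewrite exprn_gt0 // ratio_gt0.
by lia.
Qed.

Let Sgt0 : 0 < S.
Proof.
have Z1gt0 : 0 < Z1 := lt_le_trans ltr01 Z1ge1.
by rewrite /S addr_gt0 // mulr_gt0 // exprn_gt0.
Qed.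

Let sq_le (x y : R) : 0 <= x -> x <= eta * y -> x ^+ 2 <= eta ^+ 2 * y ^+ 2.
Proof.
move=> x0 xy; rewrite -exprMn lerXn2r // nnegrE //; exact: le_trans xy.
Qed.

(** The hypotheses say that [ratio] climbs by a factor [1 / eta] in the first quarter
    of the range, then descends, climbs and descends by as much.  At the three jumps
    it is therefore at most [eta] times its values inside the adjacent bumps. *)
Lemma sum_jacobi_mode_le :
  \sum_(p < (n.*2.*2).+1.*2.+1) jacobi w mode p ^+ 2 <= 507 * eta ^+ 2 * S.
Proof.
rewrite sum_jacobi_mode //.
have e2 : 0 <= eta ^+ 2 by exact: sqr_ge0.
have a1 : 1 <= eta ^+ 2 * Z1.
  rewrite -[leLHS](expr1n _ 2); apply: (le_trans (sq_le ler01 up1)).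
  by rewrite ler_wpM2l // Z1ge.
have rge k : 0 <= ratio k := ltW (ratio_gt0 k).
have a2 : ratio n.*2 ^+ 2 <= eta ^+ 2 * Z1.
  by apply: (le_trans (sq_le (rge _) down1)); rewrite ler_wpM2l // Z1ge.
have a3 : ratio n.*2 ^+ 2 <= eta ^+ 2 * Z2.
  by apply: (le_trans (sq_le (rge _) up2)); rewrite ler_wpM2l // Z2ge.
have a4 : ratio n.*2.*2 ^+ 2 <= eta ^+ 2 * Z2.
  by apply: (le_trans (sq_le (rge _) down2)); rewrite ler_wpM2l // Z2ge.
have w2 k : w k ^+ 2 <= 169.
  have -> : (169 : R) = 13 ^+ 2 by ring.
  by rewrite lerXn2r // nnegrE // (le_trans _ (w1 k)).
have z1 : 0 <= Z1 ^+ 2 by exact: sqr_ge0.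
have z2 : 0 <= Z2 ^+ 2 by exact: sqr_ge0.
have t1 : w 0%N ^+ 2 * Z2 ^+ 2 <= 169 * (eta ^+ 2 * Z1) * Z2 ^+ 2.
  apply: ler_wpM2r => //; rewrite -[leLHS]mulr1.
  by apply: ler_pM; [exact: sqr_ge0|exact: ler01|exact: w2|exact: a1].
have t2 : (w n.*2.*2.+1 * ratio n.*2) ^+ 2 * (Z1 + Z2) ^+ 2 <=
    169 * ((2 * (eta ^+ 2 * Z2)) * Z1 ^+ 2 + (2 * (eta ^+ 2 * Z1)) * Z2 ^+ 2).
  rewrite exprMn -[leLHS]mulrA; apply: ler_pM; [exact: sqr_ge0| |exact: w2|].
    by apply: mulr_ge0; exact: sqr_ge0.
  have h : (Z1 + Z2) ^+ 2 <= 2 * Z1 ^+ 2 + 2 * Z2 ^+ 2.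
    by have := sqr_ge0 (Z1 - Z2); rewrite sqrrB sqrrD; lra.
  apply: (le_trans (ler_wpM2l (sqr_ge0 _) h)); rewrite mulrDr.
  by apply: lerD; rewrite mulrCA -mulrA ler_wpM2l // ler_wpM2r.
have t3 : (w n.*2.*2.*2.+1 * ratio n.*2.*2) ^+ 2 * Z1 ^+ 2 <= 169 * (eta ^+ 2 * Z2) * Z1 ^+ 2.
  apply: ler_wpM2r => //; rewrite exprMn.
  by apply: ler_pM; [exact: sqr_ge0|exact: sqr_ge0|exact: w2|exact: a4].
apply: (le_trans (lerD (lerD t1 t2) t3)).
by rewrite /S le_eqVlt; apply/orP; left; apply/eqP; ring.
Qed.

(** The crude bound comes from [13 ^ -k <= ratio k <= 13 ^ k]; it only has to be
    independent of the weights. *)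
Definition premode_max : R := n.*2.+1%:R * 13 ^+ (8 * n) * (2 * 13 ^+ (4 * n)).

Definition mode_bound : R := ((n.*2.*2).+1.*2.+1)%:R * premode_max.

Lemma premode_max_ge1 : 1 <= premode_max.
Proof.
have p1 k : 1 <= 13 ^+ k :> R by rewrite exprn_ege1 // ler1n.
have n1 : 1 <= n.*2.+1%:R :> R by rewrite ler1n.
have m1 (x y : R) : 1 <= x -> 1 <= y -> 1 <= x * y.
  by move=> x1 y1; rewrite -[leLHS]mulr1; apply: ler_pM.
have two1 : 1 <= 2 :> R by rewrite ler1n.
exact: (m1 _ _ (m1 _ _ n1 (p1 _)) (m1 _ _ two1 (p1 _))).
Qed.

Lemma primitive_norm k : `|primitive k| <= 2 * Z1 * Z2.
Proof.
have Z1gt0 : 0 < Z1 := lt_le_trans ltr01 Z1ge1.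
rewrite /primitive; apply: (le_trans (ler_norm_sum _ _ _)).
have pos j : 0 <= `|bump_height j * ratio j ^+ 2| by [].
apply: (@le_trans _ _ (\sum_(0 <= j < (n.*2.*2).+1) `|bump_height j * ratio j ^+ 2|)).
  have [kn|nk] := leqP k (n.*2.*2).+1.
    by rewrite [leRHS](big_cat_nat (n := k)) //= lerDl sumr_ge0.
  rewrite (big_cat_nat (n := (n.*2.*2).+1)) //= ?(ltnW nk) // gerDl.
  rewrite big_nat_cond big1 // => j /andP[/andP[h _] _].
  by rewrite bump_heightE3 // mul0r normr0.
rewrite (big_cat_nat (n := n.*2.+1)) //= (_ : 2 * Z1 * Z2 = Z2 * Z1 + Z1 * Z2); last by ring.
apply: lerD.
  rewrite [in leRHS]/Z1 mulr_sumr; apply: ler_sum_nat => j /andP[_ h].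
  by rewrite bump_heightE1 // normrM (gtr0_norm Z2gt0) (ger0_norm (sqr_ge0 _)).
rewrite [in leRHS]/Z2 mulr_sumr; apply: ler_sum_nat => j h.
by rewrite bump_heightE2 // normrM normrN (gtr0_norm Z1gt0) (ger0_norm (sqr_ge0 _)).
Qed.

Lemma primitive_eq0 k : (n.*2.*2 < k)%N -> primitive k = 0.
Proof.
move=> h; rewrite /primitive (big_cat_nat (n := (n.*2.*2).+1)) //=.
rewrite [X in _ + X]big_nat_cond [X in _ + X]big1 ?addr0; last first.
  by move=> j /andP[/andP[h' _] _]; rewrite bump_heightE3 // mul0r.
rewrite (big_cat_nat (n := n.*2.+1)) //=.
rewrite (_ : \sum_(0 <= i < n.*2.+1) _ = Z2 * Z1); last first.
  rewrite /Z1 mulr_sumr; apply: eq_big_nat => j /andP[_ h'].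
  by rewrite bump_heightE1.
rewrite (_ : \sum_(n.*2.+1 <= i < _) _ = - Z1 * Z2); last first.
  rewrite [in RHS]/Z2 mulr_sumr; apply: eq_big_nat => j h'.
  by rewrite bump_heightE2.
by ring.
Qed.

Lemma premode_bound p : `|premode p| <= premode_max * Num.sqrt S.
Proof.
have Z1gt0 : 0 < Z1 := lt_le_trans ltr01 Z1ge1.
have hb0 : 0 <= premode_max * Num.sqrt S by rewrite mulr_ge0 ?sqrtr_ge0 // (le_trans _ premode_max_ge1).
rewrite /premode; case: ifP => _; first by rewrite normr0.
set k := p./2; have [kn|nk] := leqP k n.*2.*2; last by rewrite primitive_eq0 // mulr0 mul0r normr0.
rewrite !normrM normrN normrX normrN1 expr1n mul1r.
have Z2S : Z2 <= Num.sqrt S.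
  rewrite -(ler_pXn2r (n := 2)) // ?nnegrE ?sqrtr_ge0 ?(ltW Z2gt0) //.
  rewrite sqr_sqrtr ?(ltW Sgt0) // /S; apply: (@le_trans _ _ (Z1 * Z2 ^+ 2)).
    by rewrite ler_peMl // sqr_ge0.
  by rewrite lerDl mulr_ge0 ?(ltW Z2gt0) // sqr_ge0.
have Z1b : Z1 <= (n.*2.+1)%:R * 13 ^+ (8 * n).
  rewrite /Z1; apply: (@le_trans _ _ (\sum_(0 <= j < n.*2.+1) 13 ^+ (8 * n))).
    apply: ler_sum_nat => j /andP[_ h].
    apply: (@le_trans _ _ ((13 ^+ j) ^+ 2)).
      rewrite lerXn2r // ?nnegrE ?exprn_ge0 ?ratio_le //; exact: ltW (ratio_gt0 _).
    have jn : (j * 2 <= 8 * n)%N by clear -h; lia.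
    by rewrite -exprM; apply: ler_weXn2l jn; rewrite ler1n.
  by rewrite sumr_const_nat subn0 -[leLHS]mulr_natl.
have inv : `|(w p * ratio k)^-1| <= 13 ^+ (4 * n).
  rewrite gtr0_norm ?invr_gt0 ?mulr_gt0 ?ratio_gt0 //.
  rewrite invf_ple ?posrE ?mulr_gt0 ?exprn_gt0 ?ratio_gt0 //.
  rewrite -[leLHS]mul1r ler_pdivrMr ?exprn_gt0 //.
  apply: (@le_trans _ _ (ratio k * 13 ^+ k)); first exact: ratio_ge.
  apply: ler_pM => //; first exact: ltW (ratio_gt0 _).
    by rewrite ler_peMl // ltW // ratio_gt0.
  have kn4 : (k <= 4 * n)%N by clear -kn; lia.
  by apply: ler_weXn2l kn4; rewrite ler1n.
apply: (@le_trans _ _ ((2 * Z1 * Z2) * 13 ^+ (4 * n))).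
  by apply: ler_pM => //; exact: primitive_norm.
rewrite (_ : _ * _ = (Z1 * (2 * 13 ^+ (4 * n))) * Z2); last by ring.
apply: ler_pM => //; [|exact: ltW|].
  by rewrite !mulr_ge0 ?exprn_ge0 // ltW.
by rewrite /premode_max ler_wpM2r // mulr_ge0 // exprn_ge0.
Qed.

Lemma near_zero_mode_ratio (beta : R) : 507 * eta ^+ 2 <= (beta / 4) ^+ 2 ->
  near_zero_mode (n.*2.*2).+1.*2 beta mode_bound w.
Proof.
move=> hb; have S0 := Sgt0; pose c := (Num.sqrt S)^-1.
have sS : 0 < Num.sqrt S by rewrite sqrtr_gt0.
have cS : c ^+ 2 * S = 1 by rewrite /c exprVn sqr_sqrtr ?mulVf ?gt_eqF // ltW.
have jc phi p : jacobi w (fun q => c * phi q) p = c * jacobi w phi p.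
  by rewrite /jacobi mulrDr mulrCA; case: p => [|p]; rewrite ?mulr0 // [c * (w p * _)]mulrCA.
have sum1 : \sum_(p < (n.*2.*2).+1.*2.+1) (c * mode p) ^+ 2 = 1.
  by under eq_bigr do rewrite exprMn; rewrite -mulr_sumr sum_mode.
exists (fun p => c * mode p), (fun p => c * premode p); split => //.
- split; [by rewrite /mode /= mulr0 | by rewrite /premode /= /primitive big_geq // mulr0 mul0r mulr0 |].
  move=> p hp; split; rewrite /mode /premode; case: ifP => op; rewrite ?mulr0 //.
    have h3 : (n.*2.*2 < p./2)%N by move: hp op; clear; lia.
    by rewrite bump_heightE3 ?mulr0.
  have h3 : (n.*2.*2 < p./2)%N by move: hp op; clear; lia.
  by rewrite primitive_eq0 // mulr0 mul0r mulr0.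
- by move=> p _; rewrite jc jacobi_premode.
- under eq_bigr do rewrite jc exprMn; rewrite -mulr_sumr.
  apply: le_trans hb; apply: (le_trans (ler_wpM2l (sqr_ge0 _) sum_jacobi_mode_le)).
  by rewrite mulrCA cS mulr1.
- have one_hb := premode_max_ge1.
  have mb : mode_bound = ((n.*2.*2).+1.*2.+1)%:R * premode_max by [].
  split.
    rewrite mb -[X in X%:R]card_ord mulr_natl -sumr_const; apply: ler_sum => p _.
    apply: le_trans one_hb; rewrite -(@ler_pXn2r _ 2) // ?nnegrE // expr1n.
    rewrite real_normK ?num_real // -sum1 (bigD1 p) //= lerDl.
    by apply: sumr_ge0 => i _; exact: sqr_ge0.
  rewrite mb -[X in X%:R]card_ord mulr_natl -sumr_const; apply: ler_sum => p _.
  rewrite normrM /c gtr0_norm ?invr_gt0 // mulrC ler_pdivrMr //.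
  exact: premode_bound.
Qed.

End ZeroMode.

(** * Sums over sequences and random walks *)

Section SequentialSums.
Variables (R : realType) (T : finType).
Implicit Types (F : seq T -> R) (k : nat).

(** The sum of [F] over all sequences of length [k].  Summing one entry at a time
    makes the independence of the entries of a concatenation definitional. *)
Fixpoint seqsum k F : R :=
  if k is k'.+1 then \sum_(t : T) seqsum k' (fun s => F (t :: s)) else F [::].

Lemma seqsum_ffun k F :
  \sum_(f : {ffun 'I_k -> T}) F [seq f i | i <- enum 'I_k] = seqsum k F.
Proof.
elim: k F => [|k IH] F.
  rewrite (big_pred1 [ffun i : 'I_0 => match i with Ordinal _ h => False_rect T (notF h) end]).
    by rewrite enum_ord0.
  by move=> f /=; apply/esym/eqP/ffunP => -[].
pose cons_ffun (p : T * {ffun 'I_k -> T}) : {ffun 'I_k.+1 -> T} :=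
  [ffun i => if unlift ord0 i is Some j then p.2 j else p.1].
have bij : bijective cons_ffun.
  exists (fun f : {ffun 'I_k.+1 -> T} => (f ord0, [ffun j => f (lift ord0 j)])).
    move=> [t f]; congr pair; first by rewrite ffunE unlift_none.
    by apply/ffunP => j; rewrite !ffunE liftK.
  move=> f; apply/ffunP => i; rewrite !ffunE.
  by case: unliftP => [j ->|->] /=; rewrite ?ffunE.
rewrite (reindex cons_ffun) /=; last exact: onW_bij.
rewrite -(pair_bigA _ (fun t f => F [seq cons_ffun (t, f) i | i <- enum 'I_k.+1])) /=.
apply: eq_bigr => t _; rewrite -IH; apply: eq_bigr => f _; congr F.
rewrite enum_ordSl /= ffunE unlift_none /=; congr cons.
rewrite -map_comp; apply: eq_map => i /=.
by rewrite ffunE liftK.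
Qed.

Lemma seqsum_cat a b F :
  seqsum (a + b) F = seqsum a (fun s1 => seqsum b (fun s2 => F (s1 ++ s2))).
Proof. by elim: a F => [|a IH] F //=; apply: eq_bigr => t _; rewrite IH. Qed.

Lemma eq_seqsum k F G : (forall s, size s = k -> F s = G s) -> seqsum k F = seqsum k G.
Proof.
elim: k F G => [|k IH] F G h /=; first exact: h.
by apply: eq_bigr => t _; apply: IH => s sk; apply: h; rewrite /= sk.
Qed.

Lemma seqsumZ k c F : seqsum k (fun s => c * F s) = c * seqsum k F.
Proof.
elim: k F => [|k IH] F //=; rewrite mulr_sumr; apply: eq_bigr => t _.
exact: IH.
Qed.

Lemma seqsum_cst k c : seqsum k (fun _ => c) = #|T|%:R ^+ k * c.
Proof.
elim: k => [|k IH] /=; first by rewrite mul1r.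
by rewrite IH sumr_const exprS -mulrA -[LHS]mulr_natl.
Qed.
End SequentialSums.

Section Walk.
Variables (R : realType) (I : finType) (x : I -> R).
Implicit Types (Phi Psi : R -> R) (n : nat).
Hypothesis I0 : (0 < #|I|)%N.

Definition avg (f : I -> R) : R := #|I|%:R^-1 * \sum_i f i.

(** The expectation of [Phi] at the position after [n] independent steps [x i], with
    [i] uniform in [I]. *)
Fixpoint walk n Phi : R :=
  if n is n'.+1 then avg (fun i => walk n' (fun y => Phi (x i + y))) else Phi 0.

Let In0 : #|I|%:R != 0 :> R. Proof. by rewrite pnatr_eq0 -lt0n. Qed.

Lemma eq_avg f g : f =1 g -> avg f = avg g.
Proof. by move=> fg; rewrite /avg; under eq_bigr do rewrite fg. Qed.

Lemma avg_cst c : avg (fun _ => c) = c.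
Proof. by rewrite /avg sumr_const -[c *+ _]mulr_natl mulKf. Qed.

Lemma avgD f g : avg (fun i => f i + g i) = avg f + avg g.
Proof. by rewrite /avg big_split mulrDr. Qed.

Lemma avgZ c f : avg (fun i => c * f i) = c * avg f.
Proof. by rewrite /avg -mulr_sumr mulrCA. Qed.

Lemma avg_le f g : (forall i, f i <= g i) -> avg f <= avg g.
Proof.
by move=> fg; rewrite /avg ler_wpM2l ?invr_ge0 ?ler0n //; apply: ler_sum => i _.
Qed.

Lemma eq_walk n Phi Psi : Phi =1 Psi -> walk n Phi = walk n Psi.
Proof. by move=> /funext ->. Qed.

Lemma walk_cst n c : walk n (fun _ => c) = c.
Proof. by elim: n => [|n IH] //=; rewrite IH avg_cst. Qed.

Lemma walkD n Phi Psi : walk n (fun y => Phi y + Psi y) = walk n Phi + walk n Psi.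
Proof.
elim: n Phi Psi => [|n IH] Phi Psi //=; rewrite -avgD; apply: eq_avg => i.
exact: IH.
Qed.

Lemma walkZ n c Phi : walk n (fun y => c * Phi y) = c * walk n Phi.
Proof. by elim: n Phi => [|n IH] Phi //=; rewrite -avgZ; apply: eq_avg => i; exact: IH. Qed.

Lemma walk_le n Phi Psi : (forall y, Phi y <= Psi y) -> walk n Phi <= walk n Psi.
Proof. by elim: n Phi Psi => [|n IH] Phi Psi h //=; apply: avg_le => i; exact: IH. Qed.

Variables (swap : I -> I).
Hypotheses (swapK : involutive swap) (x_swap : forall i, x (swap i) = - x i).

Lemma avg_swap f : avg f = avg (fun i => f (swap i)).
Proof. by rewrite /avg (reindex_inj (inv_inj swapK)). Qed.

(** The step distribution is symmetric: [swap] exchanges [x] and [- x]. *)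
Lemma walk_opp n Phi : walk n (fun y => Phi (- y)) = walk n Phi.
Proof.
elim: n Phi => [|n IH] Phi /=; first by rewrite oppr0.
rewrite avg_swap; apply: eq_avg => i.
rewrite -[RHS]IH; apply: eq_walk => y.
by rewrite x_swap opprD opprK.
Qed.

Lemma avg_odd : avg x = 0.
Proof.
have h : avg x = - avg x.
  rewrite {1}avg_swap; under eq_avg do rewrite x_swap -mulN1r.
  by rewrite avgZ mulN1r.
lra.
Qed.

Let v := avg (fun i => x i ^+ 2).

Lemma walk_mean n : walk n id = 0.
Proof.
elim: n => [|n IH] //=; under eq_avg => i.
  rewrite (walkD n (fun=> x i) id) walk_cst IH addr0; over.
exact: avg_odd.
Qed.

Lemma walk_sq n : walk n (fun y => y ^+ 2) = n%:R * v.
Proof.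
elim: n => [|n IH] /=; first by rewrite expr0n mul0r.
under eq_avg => i.
  rewrite (eq_walk _ (_ : _ =1 fun y => x i ^+ 2 + (2 * x i * y + y ^+ 2))); last by move=> y; ring.
  rewrite walkD walk_cst walkD (walkZ n _ id) walk_mean mulr0 add0r IH; over.
by rewrite avgD avg_cst -/v mulrSr mulrDl mul1r addrC.
Qed.

Variable kappa : R.
Hypothesis hkappa : avg (fun i => x i ^+ 4) <= kappa.

(** Expanding [(x i + y) ^ 4], the odd terms vanish on average. *)
Lemma walk_fourth n : walk n (fun y => y ^+ 4) <= n%:R * kappa + 3 * n%:R ^+ 2 * v ^+ 2.
Proof.
elim: n => [|n IH] /=; first by rewrite expr0n /= mul0r expr0n mulr0 mul0r addr0.
under eq_avg => i.
  rewrite (eq_walk _ (_ : _ =1 fun y => x i ^+ 4 + (4 * x i ^+ 3 * y +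
    (6 * x i ^+ 2 * y ^+ 2 + (4 * x i * y ^+ 3 + y ^+ 4))))); last by move=> y; ring.
  rewrite walkD walk_cst walkD (walkZ n _ id) walk_mean mulr0 add0r walkD.
  rewrite (walkZ n _ (fun y => y ^+ 2)) walk_sq walkD (walkZ n _ (fun y => y ^+ 3)).
  rewrite (_ : 6 * x i ^+ 2 * (n%:R * v) = (6 * n%:R * v) * x i ^+ 2); last by ring.
  rewrite (_ : 4 * x i * _ = (4 * walk n (fun y => y ^+ 3)) * x i); last by ring.
  over.
rewrite !avgD !avgZ avg_cst avg_odd mulr0 add0r -/v.
rewrite -natr1; apply: (le_trans (lerD hkappa (lerD (lexx _) IH))).
rewrite -subr_ge0 (_ : _ - _ = 3 * v ^+ 2); last by ring.
by rewrite mulr_ge0 // sqr_ge0.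
Qed.

(** A Paley-Zygmund argument.  With [b = n v] the variance, pointwise
    [y ^ 2 <= b / 2 + y ^ 4 / (48 b) + 12 b * 1_(|y| >= a)]: this is clear for [|y| < a],
    and the arithmetic-geometric inequality otherwise.  Averaging, the fourth moment
    contributes at most [b / 4], so [|y| >= a] has probability at least [1 / 48], and by
    symmetry each of the two tails has at least half of it. *)
Lemma walk_tail n a : 0 < n%:R * v -> n%:R * kappa <= 9 * (n%:R * v) ^+ 2 ->
  0 <= a -> a ^+ 2 <= n%:R * v / 2 ->
  96^-1 <= walk n (fun y => (a <= y)%R%:R).
Proof.
set b := n%:R * v => b0 hk a0 ab.
have pt y : y ^+ 2 <= b / 2 + ((48 * b)^-1 * y ^+ 4 + (12 * b) * ((a <= y)%R%:R + (a <= - y)%R%:R)).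
  have amgm : y ^+ 2 <= (48 * b)^-1 * y ^+ 4 + 12 * b.
    rewrite -subr_ge0 (_ : _ - _ = (48 * b)^-1 * (y ^+ 2 - 24 * b) ^+ 2).
      by rewrite mulr_ge0 ?sqr_ge0 // invr_ge0 mulr_ge0 // ltW.
    by field; rewrite gt_eqF.
  have y4 : 0 <= (48 * b)^-1 * y ^+ 4.
    by rewrite mulr_ge0 ?exprn_even_ge0 // invr_ge0 mulr_ge0 // ltW.
  have [ay|ya] := leP a y.
    have p12 : 0 <= 12 * b by rewrite mulr_ge0 // ltW.
    have := mulr_ge0 p12 (ler0n R (a <= - y)%R).
    rewrite mulrDr mulr1; lra.
  have [ay|ya'] := leP a (- y); first by rewrite add0r mulr1; lra.
  have : y ^+ 2 <= a ^+ 2.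
    by rewrite -(real_normK (num_real y)) lerXn2r ?nnegrE // ler_norml; lra.
  rewrite addr0 mulr0; lra.
have := walk_le n pt; rewrite walk_sq -/b walkD walk_cst walkD !walkZ walkD.
rewrite (walk_opp n (fun y => (a <= y)%R%:R)); set p := walk n (fun y => (a <= y)%R%:R).
have h4 := walk_fourth n; have h4' : walk n (fun y => y ^+ 4) <= 12 * b ^+ 2.
  apply: (le_trans h4); rewrite /b in hk *; lra.
have : (48 * b)^-1 * walk n (fun y => y ^+ 4) <= b / 4.
  have b48 : 0 < 48 * b by rewrite pmulr_rgt0.
  rewrite mulrC ler_pdivrMr //; apply: (le_trans h4').
  by rewrite le_eqVlt; apply/orP; left; apply/eqP; field.
move=> h1 h2; rewrite -(ler_pM2l b0); lra.
Qed.

End Walk.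

Section BlockSums.
Variables (R : realType) (T : finType) (t0 : T) (l : T -> R).

(** The displacement of the walk over [n] steps, each step using two consecutive
    entries of [s], from position [off] on. *)
Definition block (n off : nat) (s : seq T) : R :=
  \sum_(i < n) (l (nth t0 s (off + i.*2)) - l (nth t0 s (off + i.*2).+1)).

Definition step (p : T * T) : R := l p.1 - l p.2.

Lemma seqsum_block n (Phi : R -> R) :
  seqsum n.*2 (fun s => Phi (block n 0 s)) = #|T|%:R ^+ n.*2 * walk step n Phi.
Proof.
have T0 : (0 < #|T|)%N by apply/card_gt0P; exists t0.
have Tn0 : #|T|%:R != 0 :> R by rewrite pnatr_eq0 -lt0n.
elim: n Phi => [|n IH] Phi; first by rewrite /= /block big_ord0 mul1r.
rewrite doubleS /= /avg card_prod natrM.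
rewrite (pair_bigA _ (fun a b => seqsum n.*2 (fun s => Phi (block n.+1 0 (a :: b :: s))))) /=.
rewrite !exprS !mulrA; set q := #|T|%:R in Tn0 *.
rewrite [q * q * _]mulrC -[X in X * _]mulrA divff ?mulf_neq0 // mulr1 mulr_sumr.
apply: eq_bigr => p _; rewrite -IH; apply: eq_seqsum => s _.
congr Phi; rewrite /block big_ord_recl /=.
by congr (_ + _).
Qed.

Lemma block_cat n k off s1 s2 : size s1 = k ->
  block n (k + off) (s1 ++ s2) = block n off s2.
Proof.
move=> <-; rewrite /block; apply: eq_bigr => i _.
rewrite -addnA -addnS !nth_cat !ltnNge !leq_addr /=.
by rewrite !addKn.
Qed.

Lemma block_catl n s1 s2 : size s1 = n.*2 -> block n 0 (s1 ++ s2) = block n 0 s1.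
Proof.
move=> h; rewrite /block; apply: eq_bigr => i _.
have hi := ltn_ord i.
have h1 : (i.*2.+1 < size s1)%N by rewrite h; move: hi; clear; lia.
by rewrite !nth_cat !add0n h1 (ltnW h1).
Qed.

(** Between the two end entries the sequence consists of four disjoint blocks of
    length [2 n], on which the factors are independent. *)
Lemma seqsum_blocks4 n (A B C D : R -> R) :
  seqsum (n.*2.*2).+1.*2 (fun s => A (block n 1 s) * (B (block n n.*2.+1 s) *
      (C (block n (n.*2 + n.*2).+1 s) * D (block n (n.*2 + n.*2 + n.*2).+1 s)))) =
  #|T|%:R ^+ (n.*2.*2).+1.*2 *
    (walk step n A * (walk step n B * (walk step n C * walk step n D))).
Proof.
set F := (fun s => _); set q := #|T|%:R.
have -> : ((n.*2.*2).+1.*2 = 1 + (n.*2 + (n.*2 + (n.*2 + (n.*2 + 1)))))%N by clear; lia.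
rewrite !exprD !expr1 seqsum_cat.
have E t s1 s2 s3 s4 s5 : size s1 = n.*2 -> size s2 = n.*2 -> size s3 = n.*2 -> size s4 = n.*2 ->
  F (t :: (s1 ++ (s2 ++ (s3 ++ (s4 ++ s5))))) =
  A (block n 0 s1) * (B (block n 0 s2) * (C (block n 0 s3) * D (block n 0 s4))).
  move=> z1 z2 z3 z4; rewrite /F -cat1s.
  have -> : (n.*2 + n.*2 + n.*2).+1 = (1 + (n.*2 + (n.*2 + (n.*2 + 0))))%N by clear; lia.
  have -> : (n.*2 + n.*2).+1 = (1 + (n.*2 + (n.*2 + 0)))%N by clear; lia.
  have -> : n.*2.+1 = (1 + (n.*2 + 0))%N by clear; lia.
  rewrite -[X in block n X ([:: t] ++ _)](addn0 1) !(block_cat _ _ _ (erefl : size [:: t] = 1%N)).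
  by rewrite !(block_cat _ _ _ z1) !(block_cat _ _ _ z2) (block_cat _ _ _ z3) !block_catl.
rewrite [seqsum 1 _]/=.
transitivity (\sum_(t : T) seqsum n.*2 (fun s1 => A (block n 0 s1) *
   (q * (q ^+ n.*2 * walk step n B * (q ^+ n.*2 * walk step n C * (q ^+ n.*2 * walk step n D)))))).
  apply: eq_bigr => t _; rewrite seqsum_cat; apply: eq_seqsum => s1 z1.
  rewrite seqsum_cat.
  transitivity (seqsum n.*2 (fun s2 => (A (block n 0 s1) *
     (q * (q ^+ n.*2 * walk step n C * (q ^+ n.*2 * walk step n D)))) * B (block n 0 s2))); last first.
    by rewrite seqsumZ seqsum_block -/q; ring.
  apply: eq_seqsum => s2 z2; rewrite seqsum_cat.
  transitivity (seqsum n.*2 (fun s3 => (A (block n 0 s1) * B (block n 0 s2) *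
     (q * (q ^+ n.*2 * walk step n D))) * C (block n 0 s3))); last first.
    by rewrite seqsumZ seqsum_block -/q; ring.
  apply: eq_seqsum => s3 z3; rewrite seqsum_cat.
  transitivity (seqsum n.*2 (fun s4 => (A (block n 0 s1) * B (block n 0 s2) *
     (q * C (block n 0 s3))) * D (block n 0 s4))); last first.
    by rewrite seqsumZ seqsum_block -/q; ring.
  apply: eq_seqsum => s4 z4; rewrite [seqsum 1 _]/=.
  under eq_bigr do rewrite E //.
  by rewrite sumr_const -[LHS]mulr_natl -/q; ring.
have qT : \sum_(t : T) (1 : R) = q by rewrite sumr_const.
rewrite sumr_const -[LHS]mulr_natl -/q.
under eq_seqsum do rewrite mulrC.
by rewrite seqsumZ seqsum_block -/q; ring.
Qed.

End BlockSums.

(** * The weights on the grid *)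

Section GridWeights.
Variables (R : realType) (N : nat) (z : R[i]).
Hypotheses (zN : N.-primitive_root z) (N3 : (2 < N)%N).
Local Notation C := R[i].
Local Notation T := {ffun 'I_3 -> 'I_N}.

Definition row_weight (a : T) : R := 7 + \sum_(i < 3) 2 * complex.Re (z ^+ a i).

Let rho (k : 'I_N) : R := complex.Re (z ^+ k).

Lemma normr_Re_le1 (y : C) : normc y = 1 -> `|complex.Re y| <= 1.
Proof.
by move=> y1; have := normc_ge_Re y; rewrite /Num.norm /= y1 lecR.
Qed.

Lemma row_weight_bounds a : 1 <= row_weight a <= 13.
Proof.
have h i : -1 <= complex.Re (z ^+ a i) <= 1.
  by rewrite -ler_norml normr_Re_le1 // (root_normX zN).
rewrite /row_weight !big_ord_recl big_ord0.
have := h ord0; have := h (lift ord0 ord0); have := h (lift ord0 (lift ord0 ord0)); lra.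
Qed.

Lemma sum_root_pow d : (0 < d < N)%N -> \sum_(k < N) (z ^+ d) ^+ k = 0.
Proof.
move=> /andP[d0 dN]; have z1 : z ^+ d - 1 != 0.
  rewrite subr_eq0 -(expr0 z) (eq_prim_root_expr zN) mod0n modn_small //.
  by rewrite -lt0n.
apply: (mulfI z1); rewrite mulr0 -subrX1 -exprM mulnC exprM.
by rewrite (prim_expr_order zN) expr1n subrr.
Qed.

Lemma sum_rho : \sum_k rho k = 0.
Proof.
rewrite /rho -raddf_sum /=; have := @sum_root_pow 1.
rewrite expr1 => -> //; by rewrite (ltn_trans _ N3).
Qed.

Lemma sum_rho_sq : \sum_k rho k ^+ 2 = N%:R / 2.
Proof.
have sq (y : C) : normc y = 1 -> complex.Re y ^+ 2 = 2^-1 + 2^-1 * complex.Re (y ^+ 2).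
  case: y => a b; rewrite /normc => h.
  have : a ^+ 2 + b ^+ 2 = 1.
    have := congr1 (fun x => x ^+ 2) h; rewrite sqr_sqrtr ?expr1n //.
    by rewrite addr_ge0 ?sqr_ge0.
  by rewrite expr2 /= => h2; lra.
rewrite (eq_bigr (fun k : 'I_N => 2^-1 + 2^-1 * complex.Re ((z ^+ 2) ^+ k))); last first.
  by move=> k _; rewrite /rho sq ?(root_normX zN) // -!exprM mulnC.
rewrite big_split /= sumr_const card_ord -mulr_sumr -raddf_sum /= sum_root_pow //.
by rewrite mulr0 addr0 -[LHS]mulr_natl.
Qed.

Lemma sum_coord (F : 'I_N -> R) i :
  \sum_(a : T) F (a i) = N%:R ^+ 2 * \sum_k F k.
Proof.
pose G (j : 'I_3) (k : 'I_N) : R := if j == i then F k else 1.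
transitivity (\sum_(a : T) \prod_j G j (a j)).
  apply: eq_bigr => a _; rewrite (bigD1 i) //= big1 /G ?eqxx ?mulr1 //.
  by move=> j /negbTE ->.
rewrite -(bigA_distr_bigA G) (bigD1 i) //= mulrC /G eqxx; congr (_ * _).
rewrite (eq_bigr (fun=> N%:R)); last by move=> j /negbTE ->; rewrite sumr_const card_ord.
rewrite prodr_const; congr (_ ^+ _).
have := cardC (pred1 i); rewrite card1 card_ord => -[h]; apply: etrans h.
by apply: eq_card => j; rewrite !inE.
Qed.

(** Distinct coordinates are independent. *)
Lemma sum_coord2 (F G : 'I_N -> R) i j : i != j -> \sum_k F k = 0 ->
  \sum_(a : T) F (a i) * G (a j) = 0.
Proof.
move=> ij F0; pose K (l : 'I_3) (k : 'I_N) : R :=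
  if l == i then F k else if l == j then G k else 1.
transitivity (\sum_(a : T) \prod_l K l (a l)).
  apply: eq_bigr => a _; rewrite (bigD1 i) //= (bigD1 j) 1?eq_sym //= big1 /K ?eqxx ?mulr1.
    by rewrite eq_sym (negbTE ij).
  by move=> l /andP[/negbTE -> /negbTE ->].
by rewrite -(bigA_distr_bigA K) (bigD1 i) //= /K eqxx F0 mul0r.
Qed.

Let osc (a : T) : R := \sum_(i < 3) 2 * rho (a i).

Lemma sum_osc : \sum_a osc a = 0.
Proof.
rewrite exchange_big big1 //= => i _.
by rewrite -mulr_sumr (sum_coord rho) sum_rho !mulr0.
Qed.

Lemma sum_osc_sq : \sum_a osc a ^+ 2 = 6 * #|{: T}|%:R.
Proof.
transitivity (\sum_(a : T) \sum_i \sum_j (2 * rho (a i)) * (2 * rho (a j))).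
  apply: eq_bigr => a _; rewrite expr2 mulr_suml; apply: eq_bigr => i _.
  by rewrite mulr_sumr.
rewrite exchange_big /= (eq_bigr (fun=> 2 * #|{: T}|%:R)).
  by rewrite sumr_const card_ord -[LHS]mulr_natl; ring.
move=> i _; rewrite exchange_big /= (bigD1 i) //= [X in _ + X]big1 ?addr0.
  under eq_bigr do rewrite -expr2 exprMn.
  rewrite -mulr_sumr (sum_coord (fun k => rho k ^+ 2)) sum_rho_sq.
  by rewrite card_ffun !card_ord natrX; field.
move=> j ji; under eq_bigr do rewrite mulrACA.
by rewrite -mulr_sumr (sum_coord2 rho) ?mulr0 // 1?eq_sym // sum_rho.
Qed.

Definition log_weight (a : T) : R := ln (row_weight a).

Let Tinh : (0 < #|{: T}|)%N.
Proof. by rewrite card_ffun !card_ord expn_gt0 (ltn_trans _ N3). Qed.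

(** Mean value theorem for [ln] on [[1, 13]], through [ln (1 + x) <= x]. *)
Lemma ln_weight_diff (x y : R) : 1 <= x <= 13 -> 1 <= y <= 13 ->
  (x - y) ^+ 2 / 169 <= (ln x - ln y) ^+ 2 <= 144.
Proof.
wlog xy : x y / y <= x.
  move=> H hx hy; have [|/ltW] := leP y x; first by move=> h; exact: H.
  have sqC (u t : R) : (u - t) ^+ 2 = (t - u) ^+ 2 by ring.
  by move=> h; rewrite (sqC x) (sqC (ln x)); exact: H.
move=> /andP[x1 x13] /andP[y1 y13].
have x0 : 0 < x by lra.
have y0 : 0 < y by lra.
have lxy : ln y <= ln x by rewrite ler_ln ?posrE.
have up : ln x - ln y <= 12.
  have x1' : -1 < x - 1 by lra.
  have := le_ln1Dx x1'; rewrite (_ : 1 + (x - 1) = x); last by ring.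
  have := ln_ge0 y1; lra.
have lo : (x - y) / 13 <= ln x - ln y.
  have yx : -1 < y / x - 1 by rewrite ltrBrDl subrr divr_gt0.
  have := le_ln1Dx yx; rewrite (_ : 1 + (y / x - 1) = y / x); last by ring.
  rewrite ln_div ?posrE // => h.
  have : (x - y) / 13 <= (x - y) / x.
    by rewrite ler_wpM2l ?subr_ge0 // lef_pV2 ?posrE.
  have -> : (x - y) / x = 1 - y / x by field; rewrite gt_eqF.
  lra.
have q0 : 0 <= (x - y) / 13 by rewrite divr_ge0 // subr_ge0.
apply/andP; split.
  have -> : (x - y) ^+ 2 / 169 = ((x - y) / 13) ^+ 2 by field.
  by rewrite lerXn2r // nnegrE // (le_trans q0).
have -> : (144 : R) = 12 ^+ 2 by ring.
by rewrite lerXn2r // nnegrE // subr_ge0.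
Qed.

(** The weight has variance [6], so the difference of two independent weights has
    mean square [12]; passing to logarithms costs at most a factor [13 ^ 2]. *)
Lemma step_variance :
  12 / 169 <= avg (fun p => step log_weight p ^+ 2).
Proof.
have q0 : #|{: T}|%:R != 0 :> R by rewrite pnatr_eq0 -lt0n.
have -> : 12 / 169 = avg (fun p : T * T => (osc p.1 - osc p.2) ^+ 2 / 169).
  rewrite /avg card_prod natrM -(pair_bigA _ (fun a b => (osc a - osc b) ^+ 2 / 169)) /=.
  have -> : \sum_a \sum_b (osc a - osc b) ^+ 2 / 169 = 12 * #|{: T}|%:R ^+ 2 / 169.
    transitivity (\sum_a (osc a ^+ 2 * #|{: T}|%:R + 6 * #|{: T}|%:R) / 169).
      apply: eq_bigr => a _; rewrite -mulr_suml; congr (_ / _).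
      under eq_bigr do rewrite sqrrB.
      rewrite big_split /= sumrB sumr_const sum_osc_sq.
      rewrite -[X in X - _]mulr_natr; congr (_ + _).
      rewrite (eq_bigr (fun b => (osc a * 2) * osc b)) ?[X in _ - X](_ : _ = 0) ?subr0 //.
        by rewrite -mulr_sumr sum_osc mulr0.
      by move=> b _; rewrite -mulr_natr; ring.
    rewrite -mulr_suml big_split /= -mulr_suml sum_osc_sq sumr_const -[X in _ + X]mulr_natl.
    by field.
  by field.
apply: avg_le => p; rewrite /step /log_weight.
have := ln_weight_diff (row_weight_bounds p.1) (row_weight_bounds p.2).
move=> /andP[h _]; apply: le_trans h; rewrite /row_weight /osc /rho.
by rewrite opprD addrACA subrr add0r.
Qed.

Lemma step_fourth :
  avg (fun p => step log_weight p ^+ 4) <= 144 * avg (fun p => step log_weight p ^+ 2).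
Proof.
rewrite -avgZ; apply: avg_le => p; rewrite (exprD _ 2 2) ler_wpM2r ?sqr_ge0 //.
by have /andP[] := ln_weight_diff (row_weight_bounds p.1) (row_weight_bounds p.2).
Qed.

(** [226] makes the variance of the walk at least [16], beyond which its fourth
    moment is comparable to the square of the variance. *)
Lemma walk_step_tail n a : (226 <= n)%N -> 0 <= a -> a ^+ 2 <= 6 * n%:R / 169 ->
  96^-1 <= walk (step log_weight) n (fun y => (a <= y)%R%:R) /\
  96^-1 <= walk (step log_weight) n (fun y => (a <= - y)%R%:R).
Proof.
move=> hn a0 an.
have I0 : (0 < #|{: T * T}|)%N by rewrite card_prod muln_gt0 Tinh.
pose swap (p : T * T) := (p.2, p.1).
have sK : involutive swap by case.
have xs p : step log_weight (swap p) = - step log_weight p by rewrite /step opprB.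
rewrite (walk_opp sK xs n (fun y => (a <= y)%R%:R)).
have n226 : 226 <= n%:R :> R by rewrite ler_nat.
have v0 := step_variance; set v := avg _ in v0.
have nv : 16 <= n%:R * v.
  apply: (@le_trans _ _ (226 * (12 / 169))); first by lra.
  by apply: ler_pM => //; lra.
suff : 96^-1 <= walk (step log_weight) n (fun y => (a <= y)%R%:R) by [].
apply: (walk_tail I0 sK xs step_fourth) => //; rewrite -/v.
- by apply: lt_le_trans nv.
- rewrite expr2; set b := n%:R * v in nv *.
  have -> : n%:R * (144 * v) = 144 * b by rewrite /b; ring.
  have : 16 * b <= b * b by rewrite ler_wpM2r //; lra.
  lra.
apply: (le_trans an); have : n%:R * (12 / 169) <= n%:R * v by rewrite ler_wpM2l.
lra.
Qed.

End GridWeights.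

(** ['X^N - 1] splits with simple roots, and [N] distinct roots of unity of order
    dividing [N] include a primitive one. *)
(** * Good characters and the final estimate *)

Lemma complex_prim_root (R : realType) (N : nat) : (0 < N)%N ->
  exists z : R[i], N.-primitive_root z.
Proof.
move=> N0; have [r rE] := closed_field_poly_normal ('X^N - 1 : {poly R[i]}).
rewrite (monicP (monicXnsubC _ N0)) scale1r in rE.
have unity : all N.-unity_root r.
  by apply/allP => y yr; rewrite /root_of_unity rE root_prod_XsubC.
have uniq_r : uniq r.
  by rewrite -separable_prod_XsubC -rE separable_Xn_sub_1 // pnatr_eq0 -lt0n.
have size_r : (N <= size r)%N.
  by rewrite -ltnS -(size_prod_XsubC r id) -rE size_XnsubC.
by have /hasP[z _ zN] := has_prim_root N0 unity uniq_r size_r; exists z.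
Qed.

Section Event.
Variables (R : realType) (n N : nat) (z : R[i]) (a : R).
Hypotheses (zN : N.-primitive_root z) (N3 : (2 < N)%N).
Hypotheses (n226 : (226 <= n)%N) (a0 : 0 <= a) (an : a ^+ 2 <= 6 * n%:R / 169).
Local Notation m := (n.*2.*2).+1.*2.
Local Notation T := {ffun 'I_3 -> 'I_N}.
Local Notation cfg := {ffun 'I_m * 'I_3 -> 'I_N}.
Implicit Types (th : cfg) (s : seq T).

Let t0 : T := [ffun _ => Ordinal (prim_order_gt0 zN)].

Definition rows th : seq T := [seq [ffun i => th (j, i)] | j <- enum 'I_m].

Definition edge_weight th (k : nat) : R := row_weight z (nth t0 (rows th) k).

Lemma edge_weightE th (j : 'I_m) : edge_weight th j = weight z th j.
Proof.
rewrite /edge_weight /rows (nth_map j) ?size_enum_ord // nth_ord_enum.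
by rewrite /row_weight /weight; under eq_bigr do rewrite ffunE.
Qed.

Lemma sum_rows (F : seq T -> R) : \sum_th F (rows th) = seqsum m F.
Proof.
rewrite -seqsum_ffun.
pose f (g : {ffun 'I_m -> T}) : cfg := [ffun d => g d.1 d.2].
rewrite (reindex f) /=.
  apply: eq_bigr => g _; congr F; apply: eq_map => j.
  by apply/ffunP => i; rewrite !ffunE.
exists (fun th => [ffun j => [ffun i => th (j, i)]]).
  by move=> g _; apply/ffunP => j; apply/ffunP => i; rewrite !ffunE.
by move=> th _; apply/ffunP => -[j i]; rewrite !ffunE.
Qed.

Let blk := block t0 (log_weight z).

(** The walk goes up, down, up and down by at least [a] over four consecutive blocks
    of [n] steps, so that its exponential [ratio] has two high bumps. *)
Definition two_bumps s : bool :=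
  [&& a <= blk n 1 s, a <= - blk n n.*2.+1 s, a <= blk n (n.*2 + n.*2).+1 s
    & a <= - blk n (n.*2 + n.*2 + n.*2).+1 s].

(** The four displacements are independent, and each exceeds [a] with probability at
    least [1 / 96]. *)
Lemma card_two_bumps :
  @volume R m N * 96^-1 ^+ 4 <= #|finset (fun th => two_bumps (rows th))|%:R.
Proof.
have vT : @volume R m N = #|{: T}|%:R ^+ m.
  have := sum_rows (fun=> 1); rewrite seqsum_cst mulr1 => <-.
  by rewrite sumr_const.
have -> : #|finset (fun th => two_bumps (rows th))|%:R = \sum_th (two_bumps (rows th))%:R :> R.
  rewrite -sum1_card natr_sum [LHS]big_mkcond /=; apply: eq_bigr => th _.
  by rewrite inE; case: (two_bumps _).
rewrite (sum_rows (fun s => (two_bumps s)%:R)).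
pose up (y : R) : R := (a <= y)%R%:R; pose dn (y : R) : R := (a <= - y)%R%:R.
rewrite (@eq_seqsum _ _ _ _ (fun s => up (blk n 1 s) * (dn (blk n n.*2.+1 s) *
    (up (blk n (n.*2 + n.*2).+1 s) * dn (blk n (n.*2 + n.*2 + n.*2).+1 s))))); last first.
  by move=> s _; rewrite /up /dn -!natrM !mulnb.
rewrite seqsum_blocks4 -vT ler_wpM2l ?ler0n //.
have [h1 h2] := walk_step_tail zN N3 n226 a0 an.
have q0 : 0 <= 96^-1 :> R by rewrite invr_ge0.
rewrite !exprS expr0 mulr1.
by do 3![apply: ler_pM; rewrite ?mulr_ge0 //].
Qed.

Lemma ln_ratio th k : ratio (edge_weight th) k = expR (blk k 1 (rows th)).
Proof.
have w0 j : 0 < edge_weight th j.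
  by have /andP[h _] := row_weight_bounds zN (nth t0 (rows th) j); exact: lt_le_trans h.
elim: k => [|k IH]; first by rewrite /ratio /blk /block !big_ord0 expR0.
rewrite /blk /block big_ord_recr /= expRD -/(block t0 (log_weight z) k 1 (rows th)) -/blk -IH.
rewrite /ratio big_ord_recr /= expRB /log_weight !lnK ?posrE //; exact: w0.
Qed.

Lemma block_add k1 k2 off s : blk (k1 + k2) off s = blk k1 off s + blk k2 (off + k1.*2) s.
Proof.
rewrite /blk /block big_split_ord /=; congr (_ + _).
by apply: eq_bigr => i _; rewrite doubleD !addnA.
Qed.

Lemma two_bumps_near_zero_mode (beta : R) th :
  507 * expR (- a) ^+ 2 <= (beta / 4) ^+ 2 -> two_bumps (rows th) ->
  near_zero_mode m beta (mode_bound R n) (edge_weight th).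
Proof.
move=> hb /and4P[h1 h2 h3 h4].
have bounds k := andP (row_weight_bounds zN (nth t0 (rows th) k)).
have e22 : n.*2 = (n + n)%N by rewrite addnn.
have E2 : blk n.*2 1 (rows th) = blk n 1 (rows th) + blk n n.*2.+1 (rows th).
  by rewrite {1}e22 block_add add1n.
have E3 : blk (n.*2 + n) 1 (rows th) = blk n.*2 1 (rows th) + blk n (n.*2 + n.*2).+1 (rows th).
  by rewrite block_add add1n addnn.
have E4 : blk n.*2.*2 1 (rows th) = blk (n.*2 + n) 1 (rows th) + blk n (n.*2 + n.*2 + n.*2).+1 (rows th).
  have -> : n.*2.*2 = (n.*2 + n + n)%N by clear; lia.
  have -> : (n.*2 + n.*2 + n.*2).+1 = (1 + (n.*2 + n).*2)%N by clear; lia.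
  exact: block_add.
apply: (@near_zero_mode_ratio R n (edge_weight th) (expR (- a))) => //.
- by move=> k; have [] := bounds k.
- by move=> k; have [] := bounds k.
- exact: leq_trans n226.
- by rewrite ln_ratio -expRD -expR0 ler_expR; lra.
- by rewrite !ln_ratio -expRD ler_expR E2; lra.
- by rewrite !ln_ratio -expRD ler_expR E3; lra.
- by rewrite !ln_ratio -expRD ler_expR E4; lra.
Qed.

End Event.

(** The side [N] of the cube is chosen after the number [n] of steps, large enough
    for the boundary errors to be negligible; it does not appear in the estimate. *)
Lemma shell_mass (R : realType) (E : projection_valued_measure R Z3wrZ (measurableTypeR R))
    (beta eps a : R) (n : nat) :
  spectral_resolution (left_mul (Z3wrZ_T R[i])) E ->
  0 < beta -> beta <= 1 -> beta < eps -> 0 <= a ->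
  507 * expR (- a) ^+ 2 <= (beta / 4) ^+ 2 ->
  (226 <= n)%N -> a ^+ 2 <= 6 * n%:R / 169 ->
  96^-1 ^+ 4 <= 4 * ((n.*2.*2).+1.*2.+1)%:R *
    sqn (E `]0, eps[%classic (l2_delta R (1%g : Z3wrZ))).
Proof.
move=> hE b0 b1 be a0 ha hn an.
pose K := mode_bound R n; pose X := 9216 * K ^+ 2 / beta ^+ 2.
pose N := ((Num.truncn X).+1 + 3)%N.
have N3 : (2 < N)%N by rewrite /N addn3.
have [z zN] := complex_prim_root R (ltn_trans (isT : (0 < 2)%N) N3).
have K0 : 0 <= K.
  by rewrite /K /mode_bound mulr_ge0 ?ler0n // (le_trans ler01) // premode_max_ge1.
have hN : 9216 * K ^+ 2 <= beta ^+ 2 * N%:R.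
  rewrite [leRHS]mulrC -ler_pdivrMr ?exprn_gt0 //; apply: (@le_trans _ _ (Num.truncn X).+1%:R).
    exact: ltW (truncnS_gt X).
  by rewrite ler_nat leq_addr.
have := near_zero_mode_count zN hE b0 b1 be K0 hN
  (S := finset (fun th => two_bumps n a zN (rows th))) (w := edge_weight zN).
move=> /(_ n (@edge_weightE R n N z zN)) h.
have V0 := volume_gt0 (n.*2.*2).+1.*2 zN.
rewrite -(ler_pM2l V0); apply: (le_trans (card_two_bumps zN N3 hn a0 an)).
apply: (le_trans (h _)).
  by move=> th; rewrite inE; exact: two_bumps_near_zero_mode.
by rewrite le_eqVlt; apply/orP; left; apply/eqP; ring.
Qed.

(** Descending to height [e ^ 3] requires the walk to move by [a = 3 |ln e|], hence
    of the order of [a ^ 2] steps: diffusive scaling. *)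
Lemma mass_near_zero (R : realType)
    (E : projection_valued_measure R Z3wrZ (measurableTypeR R)) (e : R) :
  spectral_resolution (left_mul (Z3wrZ_T R[i])) E ->
  0 < e -> 14 * e <= 1 -> 1 <= - ln e ->
  96^-1 ^+ 4 <= 160 * 100 * (- ln e) ^+ 2 *
    sqn (E `]0, e[%classic (l2_delta R (1%g : Z3wrZ))).
Proof.
move=> hE e0 e14 L1; set tau := sqn _; set L := - ln e in L1 *.
have eL : expR (- L) = e by rewrite /L opprK lnK.
pose a := 3 * L.
(* 507 / 14 ^ 4 <= 1 / 64 *)
have a0 : 0 <= a by rewrite /a; lra.
have ha : 507 * expR (- a) ^+ 2 <= (e / 2 / 4) ^+ 2.
  have -> : expR (- a) = e ^+ 3 by rewrite -eL -expRM_natl /a; congr expR; ring.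
  have e4 : (14 * e) ^+ 4 <= 1 by rewrite exprn_ile1 // mulr_ge0 // ltW.
  have -> : 507 * (e ^+ 3) ^+ 2 = (507 / 14 ^+ 4) * (14 * e) ^+ 4 * e ^+ 2 by field.
  have -> : (e / 2 / 4) ^+ 2 = 64^-1 * e ^+ 2 by field.
  rewrite ler_wpM2r ?sqr_ge0 //; lra.
(* 169 / 6 <= 29 *)
pose X := 29 * a ^+ 2.
have X0 : 0 <= X by rewrite mulr_ge0 // sqr_ge0.
pose n := ((Num.truncn X).+1 + 225)%N.
have hn : (226 <= n)%N by rewrite /n addnC; exact: (leq_add (leqnn 225) (ltn0Sn _)).
have nX : X <= n%:R.
  apply: (@le_trans _ _ (Num.truncn X).+1%:R); first exact: ltW (truncnS_gt X).
  by rewrite ler_nat leq_addr.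
have Xn : n%:R <= X + 226.
  rewrite /n natrD -natr1; have /andP[h _] := truncn_itv X0; lra.
have aL : X = 261 * L ^+ 2 by rewrite /X /a; ring.
have an : a ^+ 2 <= 6 * n%:R / 169 by move: nX; rewrite /X; have := sqr_ge0 a; lra.
have b0 : 0 < e / 2 by lra.
have b1 : e / 2 <= 1 by lra.
have be : e / 2 < e by lra.
apply: (le_trans (shell_mass hE b0 b1 be a0 ha hn an)); rewrite -/tau.
have tau0 : 0 <= tau by exact: sqn_ge0.
apply: ler_wpM2r => //.
have -> : ((n.*2.*2).+1.*2.+1)%:R = 8 * n%:R + 3 :> R.
  have -> : ((n.*2.*2).+1.*2.+1 = 8 * n + 3)%N by clear; lia.
  by rewrite natrD natrM.
have L21 : 1 <= L ^+ 2 by rewrite exprn_ege1.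
move: Xn; rewrite aL; lra.
Qed.

Lemma small_positive_near (R : realType) :
  \forall e \near (0 : R)^'+, [/\ 0 < e, 14 * e <= 1 & 1 <= - ln e].
Proof.
have p1 : 0 < expR (- 1) :> R by exact: expR_gt0.
have p2 : 0 < 14^-1 :> R by rewrite invr_gt0.
near=> e; have e0 : 0 < e by near: e; exact: nbhs_right_gt.
have e1 : e < expR (- 1) by near: e; exact: nbhs_right_lt.
have e2 : e < 14^-1 by near: e; exact: nbhs_right_lt.
split => //; first by rewrite -ler_pdivlMl // mulr1 ltW.
by rewrite lerNr -[leRHS]expRK ler_ln ?posrE // ltW.
Unshelve. all: by end_near.
Qed.

Theorem corollary12 (R : realType)
    (E : projection_valued_measure R Z3wrZ (measurableTypeR R))
    (hE : spectral_resolution (left_mul (Z3wrZ_T R[i])) E) :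
  exists2 C : R, 0 < C &
    \forall e \near 0^'+,
      ((C / `|ln e| ^+ 3)%:E <= spectral_measure E `]0%R, e[%classic)%E.
Proof.
pose c0 : R := 96^-1 ^+ 4 / (160 * 100).
have c1 : 0 < 160 * 100 :> R by rewrite mulr_gt0.
exists c0; first by rewrite divr_gt0 // exprn_gt0 // invr_gt0.
apply: filterS (small_positive_near R) => e [e0 e14 L1].
have h := mass_near_zero hE e0 e14 L1.
rewrite spectral_measureE lee_fin; set tau := sqn _ in h *.
have tau0 : 0 <= tau by exact: sqn_ge0.
have ln0 : ln e <= 0 by rewrite -oppr_ge0 (le_trans ler01).
rewrite (ler0_norm ln0) /c0.
move: (- ln e) (160 * 100) (tau) L1 c1 h tau0 => L k x L1 k0 h x0.
have L3 : 0 < L ^+ 3 by rewrite exprn_gt0 // (lt_le_trans ltr01).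
rewrite ler_pdivrMr // ler_pdivrMr //; apply: (le_trans h).
rewrite (_ : k * L ^+ 2 * x = x * L ^+ 2 * k); last by ring.
apply: ler_wpM2r; first exact: ltW.
by apply: ler_wpM2l => //; apply: ler_weXn2l.
Qed.
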